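(* (Clark formula) For any $F\in L^2(\mathbf P)$, $$F=\mathbf E[F]+\sum_{(t,k)\in\mathbb X}\mathbf E\big[D_{(t,k)}F\,\big|\,\mathcal F_{t-1}\big]\,\Delta R_{(t,k)},$$ with convergence in $L^2(\mathbf P)$.
   Context: Notation: $\mathbf N=\{1,2,\dots\}$. $E$ is a countable (possibly finite) subset of $\mathbf Z$, $\mathbb X=\mathbf N\times E$, $\lambda\in(0,1)$, and $\mathbf Q$ is a probability measure on $E$ with $\mathbf Q(\{k\})>0$ for all $k\in E$. The marked binomial process is the random measure $\eta=\sum_{i\ge 1}\delta_{(T_i,V_i)}$ on $\mathbb X$, where $T_i=\xi_1+\dots+\xi_i$ with $\xi_j$ i.i.d. geometric of parameter $\lambda$ (values in $\mathbf N$), and $(V_i)$ is i.i.d. with law $\mathbf Q$, independent of $(T_i)$. Equivalently, independently for each $t\in\mathbf N$, $\eta$ has no point at time $t$ with probability $1-\lambda$ and exactly one point $(t,k)$ with probability $\lambda\mathbf Q(\{k\})$. $L^2(\mathbf P)=L^2(\Omega,\sigma(\eta),\mathbf P)$; $\mathcal F_0$ is trivial and $\mathcal F_t=\sigma\{\eta(\{(s,k)\}): s\le t,k\in E\}$. Increments: $\Delta Z_{(t,k)}=\mathbf 1_{\{(t,k)\in\eta\}}-\lambda\mathbf Q(\{k\})$. Enumerate $E=\{k^1,k^2,\dots\}$ and set $\Delta R_{(t,k^1)}=\Delta Z_{(t,k^1)}$, $\Delta R_{(t,k^n)}=\Delta Z_{(t,k^n)}-\sum_{j=1}^{n-1}\gamma_{nj}\Delta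 R_{(t,k^j)}$, with $\gamma_{nj}=\mathbf E[\Delta Z_{(1,k^n)}\Delta R_{(1,k^j)}]/\mathbf E[(\Delta R_{(1,k^j)})^2]$. Put $\kappa_k=\mathbf E[(\Delta R_{(1,k)})^2]$. Multiple integrals: $\mathbb X^{n,<}$ is the set of $n$-tuples of $\mathbb X$ with $t_1<\dots<t_n$. $L^2(\mathbb X)^{\circ n}$ is the space of symmetric functions on $\mathbb X^n$ (identified when they agree at points with pairwise distinct times) with $n!\sum_{\mathbb X^{n,<}}f_n^2\prod_i\kappa_{k_i}<\infty$. $J_0(c)=c$, $J_n(f_n)=n!\sum_{\mathbb X^{n,<}}f_n\prod_{i=1}^n\Delta R_{(t_i,k_i)}$. Every $F\in L^2(\mathbf P)$ has a unique chaotic expansion $F=\mathbf E[F]+\sum_{n\ge1}J_n(f_n)$. Gradient: for $F$ with this expansion, $D_{(t,k)}F=\sum_{n\ge1}n\,J_{n-1}\big(f_n(\star,(t,k))\mathbf 1_{\{t_i\ne t,\,1\le i\le n-1\}}\big)$, where $\star=((t_1,k_1),\dots,(t_{n-1},k_{n-1}))$; for each fixed $(t,k)$ this series converges in $L^2(\mathbf P)$ for every $F\in L^2(\mathbf P)$. *)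

(* Defs.v *)
From HB Require Import structures.
From mathcomp Require Import all_boot all_order all_algebra all_fingroup finmap.
From mathcomp Require Import all_classical all_reals all_analysis.
From mathcomp Require Import measurable_realfun.
From mathcomp Require summability.

Set Implicit Arguments.
Unset Strict Implicit.
Unset Printing Implicit Defensive.

Import Order.TTheory GRing.Theory Num.Theory.
Import numFieldNormedType.Exports.

Local Open Scope classical_set_scope.
Local Open Scope ring_scope.

HB.instance Definition _ := isPointed.Build int 0.
HB.instance Definition _ := @isMeasurable.Build default_measure_display
  int discrete_measurable discrete_measurable0
  discrete_measurableC discrete_measurableU.

(* [x.1] is the time and [x.2] the mark. *)
Notation point_tm := (nat * int)%type.

Section Generalities.
Context {d : measure_display} {T : measurableType d} {R : realType}.
Variable P : probability T R.

Definition sigma_gen {d' : measure_display} {U : measurableType d'} {I : Type}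
    (D : set I) (X : I -> T -> U) : set_system T :=
  <<s \bigcup_(i in D) g_sigma_algebra_preimage (X i) >>.

Definition mutually_independent {I : choiceType} (G : I -> set_system T) : Prop :=
  forall (J : {fset I}) (A : I -> set T), (forall i, i \in J -> G i (A i)) ->
    P (\bigcap_(i in [set` J]) A i) = (\prod_(i <- J) P (A i))%E.

Definition independent2 (G H : set_system T) : Prop :=
  forall A B, G A -> H B -> P (A `&` B) = (P A * P B)%E.

Definition mean (X : T -> R) : R := fine 'E_P[X].

Definition adapted (G : set_system T) (X : T -> R) : Prop :=
  forall B : set R, measurable B -> G (X @^-1` B).

Definition is_condexp (G : set_system T) (X Y : T -> R) : Prop :=
  [/\ adapted G Y, P.-integrable setT (EFin \o Y) &
      forall A, G A ->
        (\int[P]_(w in A) (Y w)%:E = \int[P]_(w in A) (X w)%:E)%E].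

(* Some version of E[X | G]; the value 0 is used only if there is none. *)
Definition condexp (G : set_system T) (X : T -> R) : T -> R :=
  xget (cst 0) [set Y | is_condexp G X Y].

Definition in_L2 (G : set_system T) (X : T -> R) : Prop :=
  adapted G X /\ finite_norm P 2%:E X.

Definition L2_cvg (G : set_system T) {I : Type} (Phi : set_system I)
    (X : I -> T -> R) (Y : T -> R) : Prop :=
  in_L2 G Y /\
  ('N[P]_2%:E[EFin \o (fun w => (X i w - Y w)%R)]%E @[i --> Phi] --> 0%E).

(* Some representative of the limit; the value 0 is used only if there is
   none. *)
Definition L2_lim (G : set_system T) {I : Type} (Phi : set_system I)
    (X : I -> T -> R) : T -> R :=
  xget (cst 0) [set Y | L2_cvg G Phi X Y].

(* Sums over a countable set are unordered: [totally] is the filter of the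
   large finite subsets. *)
Definition partial_sum {I : choiceType} (A : set I) (X : I -> T -> R)
    (J : {fset I}) : T -> R :=
  fun w => \sum_(i <- J | i \in A) X i w.

End Generalities.

Section MarkedBinomial.
Context {d : measure_display} {T : measurableType d} {R : realType}.
Variable P : probability T R.
Variables (xi : nat -> {RV P >-> nat}) (V : nat -> {RV P >-> int}).

(* Indices are shifted by one: [xi j], [V i] and [arrival i] are
   $\xi_{j+1}$, $V_{i+1}$ and $T_{i+1}$. *)
Definition arrival (i : nat) (w : T) : nat := (\sum_(j < i.+1) xi j w)%N.

Definition marked_process (w : T) : {measure set point_tm -> \bar R} :=
  mseries (fun i => \d_(arrival i w, V i w)) 0.

Record is_marked_binomial (lam : R) (E : set int) (Q : probability int R) :
    Prop := IsMarkedBinomial {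
  xi_gt0 : forall j w, (0 < xi j w)%N ;
  xi_geometric : forall j m,
    P (xi j @^-1` [set m.+1]) = (lam * (1 - lam) ^+ m)%:E ;
  xi_indep : mutually_independent P (fun j => g_sigma_algebra_preimage (xi j)) ;
  mark_in : forall i w, E (V i w) ;
  mark_law : forall i (A : set int), distribution P (V i) A = Q A ;
  mark_indep : mutually_independent P (fun i => g_sigma_algebra_preimage (V i)) ;
  arrival_mark_indep :
    independent2 P (sigma_gen setT arrival) (sigma_gen setT V)
}.

End MarkedBinomial.

(* [E] is listed as [e 0, e 1, ...] without repetition, the set of indices
   being an initial segment of nat, or the whole of it. *)
Definition enumeration (I : set nat) (E : set int) (e : nat -> int) : Prop :=
  (forall m n, (m <= n)%N -> I n -> I m) /\ set_bij I E e.

Section Chaos.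
Context {d : measure_display} {T : measurableType d} {R : realType}.
Variable P : probability T R.
Variables (lam : R) (E : set int) (Q : probability int R).
Variables (I : set nat) (e : nat -> int).
Variable eta : T -> {measure set point_tm -> \bar R}.

Definition XX : set point_tm := [set x | (0 < x.1)%N /\ E x.2].

Definition sigma_eta : set_system T :=
  sigma_gen [set A | A `<=` XX] (fun A w => eta w A).

Definition filtration (t : nat) : set_system T :=
  sigma_gen [set x | XX x /\ (x.1 <= t)%N] (fun x w => eta w [set x]).

Definition dZ (x : point_tm) (w : T) : R :=
  \1_[set w' | (0 < eta w' [set x])%E] w - lam * fine (Q [set x.2]).

(* Gram-Schmidt: the list of the functions $(t, w) \mapsto
   \Delta R_{(t, e_j)}(w)$ for j < n. *)
Fixpoint gram_schmidt (n : nat) : seq (nat -> T -> R) :=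
  if n is m.+1 then
    let s := gram_schmidt m in
    let R_ j := nth (fun _ _ => 0) s j in
    rcons s (fun t w => dZ (t, e m) w -
      \sum_(j < m) mean P (fun v => dZ (1%N, e m) v * R_ j 1%N v) /
                   mean P (fun v => R_ j 1%N v ^+ 2) * R_ j t w)
  else [::].

Definition dR_idx (n t : nat) (w : T) : R :=
  nth (fun _ _ => 0) (gram_schmidt n.+1) n t w.

Definition gamma (n j : nat) : R :=
  mean P (fun v => dZ (1%N, e n) v * dR_idx j 1 v) /
  mean P (fun v => dR_idx j 1 v ^+ 2).

Lemma size_gram_schmidt n : size (gram_schmidt n) = n.
Proof. by elim: n => //= n IH; rewrite size_rcons IH. Qed.

Lemma nth_gram_schmidt n j : (j < n)%N ->
  nth (fun _ _ => 0) (gram_schmidt n) j = dR_idx j.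
Proof.
elim: n => // n IH; rewrite ltnS leq_eqVlt => /predU1P[-> //|jn].
by rewrite /= nth_rcons size_gram_schmidt jn IH.
Qed.

Lemma dR_idxE n t w : dR_idx n t w =
  dZ (t, e n) w - \sum_(j < n) gamma n j * dR_idx j t w.
Proof.
rewrite /dR_idx /= nth_rcons size_gram_schmidt ltnn eqxx.
by congr (_ - _); apply: eq_bigr => j _; rewrite nth_gram_schmidt.
Qed.

Definition rank (k : int) : nat := xget 0%N [set n | I n /\ e n = k].

Definition dR (x : point_tm) : T -> R := dR_idx (rank x.2) x.1.

Definition kappa (k : int) : R := mean P (fun w => dR (1%N, k) w ^+ 2).

Definition Xn (n : nat) : set (n.-tuple point_tm) :=
  [set x | forall i, XX (tnth x i)].

Definition Xlt (n : nat) : set (n.-tuple point_tm) :=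
  [set x | Xn x /\ sorted ltn [seq p.1 | p <- x]].

Arguments Xn n : clear implicits.
Arguments Xlt n : clear implicits.

(* The space of kernels of order n; its elements only matter on tuples with
   pairwise distinct times. *)
Definition kernel_L2 (n : nat) (f : n.-tuple point_tm -> R) : Prop :=
  (forall (s : 'S_n) x, Xn n x -> f [tuple tnth x (s i) | i < n] = f x) /\
  ((n`!%:R)%:E *
    (\esum_(x in Xlt n) (f x ^+ 2 * \prod_(i < n) kappa (tnth x i).2)%:E)
      < +oo)%E.

(* For n = 0, [Xlt 0] contains only the empty tuple, and [multint f] is almost
   surely equal to the constant [f [tuple]]. *)
Definition multint (n : nat) (f : n.-tuple point_tm -> R) : T -> R :=
  fun w => n`!%:R * L2_lim P sigma_eta summability.totally
    (partial_sum (Xlt n) (fun x v => f x * \prod_(i < n) dR (tnth x i) v)) w.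

Definition is_chaos (F : T -> R) (f : forall n, n.-tuple point_tm -> R) : Prop :=
  (forall n, (0 < n)%N -> kernel_L2 (f n)) /\
  L2_cvg P sigma_eta \oo
    (fun N w => mean P F + \sum_(1 <= n < N) multint (f n) w) F.

Definition slice (n : nat) (f : n.+1.-tuple point_tm -> R) (x : point_tm)
    (y : n.-tuple point_tm) : R :=
  f [tuple of rcons y x] * (all (fun p => p.1 != x.1) y)%:R.

(* The chaotic expansion of F being unique, this is a representative of the
   class of $D_x F$; the value 0 is used only if there is no expansion, or if
   the series of the gradient diverges. *)
Definition gradient (F : T -> R) (x : point_tm) : T -> R :=
  xget (cst 0) [set Y | exists2 f, is_chaos F f &
    L2_cvg P sigma_eta \oo
      (fun N w => \sum_(0 <= n < N) n.+1%:R * multint (slice (f n.+1) x) w) Y].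

End Chaos.

Arguments Xn E n : clear implicits.
Arguments Xlt E n : clear implicits.

(* Main.v *)
(** The variables [dR x] at distinct times are independent of each other, and
    those at a given time are orthogonal and span, with the constants, the
    functions of the points at that time.  Hence the products
    [chaos z = \prod_(x <- z) dR x], over the sequences [z] of points with
    increasing times, form an orthogonal basis of [L^2], in which every
    identity is tested.  The gradient [D_x F] has the same inner products as
    [F * dR x / kappa] with the [chaos y] such that the time of [x] does not
    occur in [y], so [C_x = E[D_x F | F_(t-1)]] is the orthogonal projection of
    [F * dR x / kappa] on the closed span of the [chaos y] with times [< t].
    The variables [C_x * dR x] are therefore orthogonal, and each is the
    projection of [F] on its own line: by Bessel and Riesz-Fischer their sum
    converges, and [F - E[F]] minus this sum is orthogonal to every [chaos z],
    hence is 0. *)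

Require Import Defs.
From HB Require Import structures.
From mathcomp Require Import all_boot all_order all_algebra all_fingroup finmap.
From mathcomp Require Import all_classical all_reals all_analysis.
From mathcomp Require Import measurable_realfun.
From mathcomp Require Import zify ring lra.
From mathcomp Require summability.

Set Implicit Arguments.
Unset Strict Implicit.
Unset Printing Implicit Defensive.

Import Order.TTheory GRing.Theory Num.Theory.
Import numFieldNormedType.Exports.

Local Open Scope classical_set_scope.
Local Open Scope ring_scope.

(* Independence in time is not a hypothesis: the process is built from geometric gaps, so the
   independence of [hit x] from the strict past has to be extracted, by cutting the past into
   countably many cells and using the lack of memory of the gap on each. Multiple integrals,
   gradient and conditional expectation are selected among candidates, with default value 0.
   Existence must be proved before a selected object can be used, and it is known only up to a null
   set; hence identities are stated as equalities of inner products or as [sqnorm = 0]. No kernel is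
   estimated by hand. Bessel's inequality for a variable already in $L^2$ ($F$ for the expansion,
   $F\,\Delta R_x/\kappa$ for the gradient) gives at once square summability and convergence. When
   $E$ is infinite, each $\Delta R$ still involves finitely many marks: it is bounded, so products
   with it stay in $L^2$, and the triangular Gram-Schmidt system is inverted by finite sums. Finally
   $C_x$ is only a limit of chaoses, so that second moment computations with it are made first on
   chaoses and then extended by continuity. *)
#[local] Existing Instance summability.totally_filter.

(** * The Hilbert space [L^2] *)

Section InnerProduct.
Context {d : measure_display} {T : measurableType d} {R : realType}.
Variable P : probability T R.
Implicit Types X Y Z W : T -> R.

Definition inner X Y : R := mean P (fun w => X w * Y w).

Definition L2 X := X \in Lfun P 2%:E.

Lemma L2P X : L2 X <-> measurable_fun setT X /\ finite_norm P 2%:E X.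
Proof.
split=> [/andP[]|[mX fX]]; first by rewrite !inE.
by apply/andP; rewrite !inE.
Qed.

Lemma L2_measurable X : L2 X -> measurable_fun setT X.
Proof. by case/L2P. Qed.

Lemma eq_L2 X Y : X =1 Y -> L2 X -> L2 Y.
Proof. by move=> /funext ->. Qed.

Lemma L2_mul X Y : L2 X -> L2 Y -> (fun w => X w * Y w) \in Lfun P 1.
Proof. exact: Lfun2_mul_Lfun1. Qed.

Lemma L2_Lfun1 X : L2 X -> X \in Lfun P 1.
Proof. by apply: Lfun_subset12; rewrite fin_num_measure. Qed.

Lemma L2D X Y : L2 X -> L2 Y -> L2 (fun w => X w + Y w).
Proof. exact: ((Lfun_addr_closed P (lee1n 2)).2 X Y). Qed.

Lemma L2Z a X : L2 X -> L2 (fun w => a * X w).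
Proof.
move=> hX; have := Lfun_scale a (_ : 1 <= 2) hX; rewrite ler1n => /(_ isT).
by apply: eq_L2 => w /=; rewrite mulrC.
Qed.

Lemma L2N X : L2 X -> L2 (fun w => - X w).
Proof. by move/(L2Z (-1)); apply: eq_L2 => w; rewrite mulN1r. Qed.

Lemma L2B X Y : L2 X -> L2 Y -> L2 (fun w => X w - Y w).
Proof. by move=> hX hY; apply: L2D => //; exact: L2N. Qed.

Lemma L2_cst c : L2 (fun=> c).
Proof. exact: Lfun_cst. Qed.

Lemma L2_sum (I : Type) (r : seq I) (p : pred I) (X : I -> T -> R) :
  (forall i, p i -> L2 (X i)) -> L2 (fun w => \sum_(i <- r | p i) X i w).
Proof.
move=> hX; elim: r => [|i r IH].
  by apply: eq_L2 (L2_cst 0) => w; rewrite big_nil.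
have [pi|pi] := boolP (p i).
  by apply: eq_L2 (L2D (hX i pi) IH) => w; rewrite big_cons pi.
by apply: eq_L2 IH => w; rewrite big_cons (negbTE pi).
Qed.

Lemma L2_sqr_integrable X : measurable_fun setT X ->
  P.-integrable setT (fun w => (X w ^+ 2)%:E) -> L2 X.
Proof.
move=> mX /integrableP[_ iX]; apply/L2P; split => //.
rewrite /finite_norm unlock; apply: poweR_lty; apply: le_lt_trans iX.
rewrite le_eqVlt; apply/orP; left; apply/eqP; apply: eq_integral => w _ /=.
by rewrite normrX powR_mulrn.
Qed.

Lemma L2_bounded_mul M X W : measurable_fun setT W -> (forall w, `|W w| <= M) ->
  L2 X -> L2 (fun w => X w * W w).
Proof.
move=> mW bW hX; have mX := L2_measurable hX.
have mXW : measurable_fun setT (fun w => X w * W w) by exact: measurable_funM.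
apply: L2_sqr_integrable => //.
have := Lfun2_integrable_sqr (L2Z M hX).
apply: le_integrable => //.
  by apply/measurable_EFinP; exact: measurable_funX.
move=> w _ /=; rewrite lee_fin !normrX !normrM ler_sqr ?nnegrE ?mulr_ge0//.
rewrite mulrC ler_wpM2r//; apply: le_trans (bW w) _; exact: ler_norm.
Qed.

Lemma L2_bounded M W : measurable_fun setT W -> (forall w, `|W w| <= M) -> L2 W.
Proof.
move=> mW bW; have := L2_bounded_mul mW bW (L2_cst 1).
by apply: eq_L2 => w; rewrite mul1r.
Qed.

Lemma L2_indic (A : set T) : measurable A -> L2 (\1_A : T -> R).
Proof.
move=> mA; apply: (@L2_bounded 1) => // w.
by rewrite indicE; case: (_ \in _); rewrite ?normr1 ?normr0.
Qed.

Lemma meanD X Y : X \in Lfun P 1 -> Y \in Lfun P 1 ->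
  mean P (fun w => X w + Y w) = mean P X + mean P Y.
Proof.
by move=> hX hY; rewrite /mean -fineD ?expectation_fin_num// -expectationD.
Qed.

Lemma meanZ a X : X \in Lfun P 1 -> mean P (fun w => a * X w) = a * mean P X.
Proof.
move=> hX; rewrite /mean -[X in X * _]/(fine a%:E) -fineM ?expectation_fin_num//.
by rewrite -expectationZl//; congr (fine 'E_P[_]); apply/funext => w /=; rewrite mulrC.
Qed.

Lemma mean_ge0 X : (forall w, 0 <= X w) -> 0 <= mean P X.
Proof. by move=> X0; rewrite fine_ge0// expectation_ge0. Qed.

Lemma mean_cst c : mean P (fun=> c) = c.
Proof. by rewrite /mean (expectation_cst P c). Qed.

Lemma mean_indic (A : set T) : measurable A -> mean P (\1_A) = fine (P A).
Proof. by move=> mA; rewrite /mean expectation_indic. Qed.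

Lemma mean_integral (X : T -> R) (A : set T) : measurable A ->
  mean P (fun w => X w * \1_A w) = fine (\int[P]_(w in A) (X w)%:E).
Proof.
move=> mA; rewrite /mean unlock [in RHS]integral_mkcond; congr fine.
apply: eq_integral => w _; rewrite patchE indicE.
by case: ifPn => _; rewrite ?mulr1 ?mulr0.
Qed.

Lemma innerC X Y : inner X Y = inner Y X.
Proof. by congr mean; apply/funext => w; rewrite mulrC. Qed.

Lemma innerDl X Y W : L2 X -> L2 Y -> L2 W ->
  inner (fun w => X w + Y w) W = inner X W + inner Y W.
Proof.
move=> hX hY hW; rewrite /inner -meanD ?L2_mul//; congr mean.
by apply/funext => w; rewrite mulrDl.
Qed.

Lemma innerZl a X W : L2 X -> L2 W -> inner (fun w => a * X w) W = a * inner X W.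
Proof.
move=> hX hW; rewrite /inner -meanZ ?L2_mul//; congr mean.
by apply/funext => w; rewrite mulrA.
Qed.

Lemma innerBl X Y W : L2 X -> L2 Y -> L2 W ->
  inner (fun w => X w - Y w) W = inner X W - inner Y W.
Proof.
move=> hX hY hW.
have -> : (fun w => X w - Y w) = (fun w => X w + -1 * Y w).
  by apply/funext => w; rewrite mulN1r.
by rewrite innerDl ?L2Z// innerZl// mulN1r.
Qed.

Lemma innerDr X Y W : L2 X -> L2 Y -> L2 W ->
  inner W (fun w => X w + Y w) = inner W X + inner W Y.
Proof. by move=> hX hY hW; rewrite innerC innerDl// !(innerC W). Qed.

Lemma innerZr a X W : L2 X -> L2 W -> inner W (fun w => a * X w) = a * inner W X.
Proof. by move=> hX hW; rewrite innerC innerZl// (innerC W). Qed.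

Lemma innerBr X Y W : L2 X -> L2 Y -> L2 W ->
  inner W (fun w => X w - Y w) = inner W X - inner W Y.
Proof. by move=> hX hY hW; rewrite innerC innerBl// !(innerC W). Qed.

Lemma inner_suml (I : Type) (r : seq I) (p : pred I) (X : I -> T -> R) W :
  (forall i, p i -> L2 (X i)) -> L2 W ->
  inner (fun w => \sum_(i <- r | p i) X i w) W = \sum_(i <- r | p i) inner (X i) W.
Proof.
move=> hX hW; elim: r => [|i r IH].
  rewrite big_nil -[RHS](mean_cst 0); congr mean.
  by apply/funext => w; rewrite big_nil mul0r.
rewrite big_cons -IH; case: ifPn => pi; last first.
  by congr mean; apply/funext => w; rewrite big_cons (negbTE pi).
rewrite -innerDl ?hX ?L2_sum//; congr mean.
by apply/funext => w; rewrite big_cons pi.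
Qed.

Lemma inner_cst1 X : inner X (fun=> 1) = mean P X.
Proof. by congr mean; apply/funext => w; rewrite mulr1. Qed.

Definition sqnorm X := inner X X.

Lemma sqnorm_ge0 X : 0 <= sqnorm X.
Proof. by apply: mean_ge0 => w; rewrite -expr2 sqr_ge0. Qed.

Lemma sqnormD X Y : L2 X -> L2 Y ->
  sqnorm (fun w => X w + Y w) = sqnorm X + inner X Y *+ 2 + sqnorm Y.
Proof.
move=> hX hY; have hXY := L2D hX hY; rewrite /sqnorm innerDl// !innerDr//.
by rewrite (innerC Y X); ring.
Qed.

Lemma sqnormZ a X : L2 X -> sqnorm (fun w => a * X w) = a ^+ 2 * sqnorm X.
Proof. by move=> hX; rewrite /sqnorm innerZl ?L2Z// innerZr//; ring. Qed.

Lemma sqnormB X Y : L2 X -> L2 Y ->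
  sqnorm (fun w => X w - Y w) = sqnorm X - inner X Y *+ 2 + sqnorm Y.
Proof.
move=> hX hY; have hXY := L2B hX hY; rewrite /sqnorm innerBl// !innerBr//.
by rewrite (innerC Y X); ring.
Qed.

Lemma sqnormBC X Y : sqnorm (fun w => X w - Y w) = sqnorm (fun w => Y w - X w).
Proof. by congr mean; apply/funext => w; ring. Qed.

Lemma sqnorm_triangle X Y Z : L2 X -> L2 Y -> L2 Z ->
  sqnorm (fun w => X w - Z w) <=
  2 * sqnorm (fun w => X w - Y w) + 2 * sqnorm (fun w => Y w - Z w).
Proof.
move=> hX hY hZ.
pose U w := X w - Y w; pose V w := Y w - Z w.
have hU : L2 U by exact: L2B.
have hV : L2 V by exact: L2B.
have -> : (fun w => X w - Z w) = (fun w => U w + V w).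
  by apply/funext => w; rewrite /U /V; ring.
rewrite -/U -/V sqnormD//; have := sqnorm_ge0 (fun w => U w - V w).
by rewrite sqnormB//; lra.
Qed.

Lemma cauchy_schwarz X Y : L2 X -> L2 Y -> inner X Y ^+ 2 <= sqnorm X * sqnorm Y.
Proof.
move=> hX hY.
have q a b : 0 <= a ^+ 2 * sqnorm X + a * b * inner X Y *+ 2 + b ^+ 2 * sqnorm Y.
  have := sqnorm_ge0 (fun w => a * X w + b * Y w).
  rewrite sqnormD ?L2Z// !sqnormZ// innerZl ?L2Z// innerZr//.
  by rewrite mulrA.
have X0 := sqnorm_ge0 X; have Y0 := sqnorm_ge0 Y.
move: q X0 Y0; move: (inner X Y) (sqnorm X) (sqnorm Y) => c x y q x0 y0.
have [yE|yN] := eqVneq y 0.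
  have [-> |cN] := eqVneq c 0; first by rewrite expr0n mulr_ge0.
  (* For [y = 0] the form is affine in its second argument; this choice gives it the value
     [- x - 2 < 0]. *)
  have := q 1 (- (x + 1) / c); rewrite yE mulr0 addr0.
  have -> : 1 * (- (x + 1) / c) * c = - (x + 1) by field.
  by rewrite expr1n; lra.
have {yN}y0 : 0 < y by rewrite lt_def yN.
have := q y (- c); have -> : y ^+ 2 * x + y * - c * c *+ 2 + (- c) ^+ 2 * y =
  y * (x * y - c ^+ 2) by ring.
by rewrite pmulr_rge0// subr_ge0.
Qed.

Lemma Lnorm2E X : L2 X -> 'N[P]_2%:E[EFin \o X]%E = (Num.sqrt (sqnorm X))%:E.
Proof.
move=> hX; have [mX fX] := (L2P _).1 hX.
have iX : (\int[P]_w (`|(EFin \o X) w| `^ 2) = (sqnorm X)%:E)%E.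
  rewrite /sqnorm /inner /mean fineK ?expectation_fin_num ?L2_mul// unlock.
  apply: eq_integral => w _ /=.
  by rewrite powR_mulrn// -normrX ger0_norm ?sqr_ge0// expr2.
rewrite unlock iX poweR_EFin; congr EFin.
by rewrite powR12_sqrt// sqnorm_ge0.
Qed.

Lemma sqnorm0_ae X : L2 X -> sqnorm X = 0 -> ae_eq P setT X (cst 0).
Proof.
move=> hX X0; have mX := L2_measurable hX.
have := Lnorm2E hX; rewrite X0 sqrtr0.
move/(Lnorm_eq0_eq0 (p := 2%:E)) => [||N [mN PN sN]].
- exact/measurable_EFinP.
- by rewrite lte_fin ltr0n.
- by exists N; split => // w /= Xw; apply: sN => /= h; apply: Xw => _; have [] := h I.
Qed.

Lemma inner_sqnorm0 X W : L2 X -> L2 W -> sqnorm X = 0 -> inner X W = 0.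
Proof.
move=> hX hW X0; have := cauchy_schwarz hX hW; rewrite X0 mul0r => h.
by apply/eqP; rewrite -sqrf_eq0 eq_le h sqr_ge0.
Qed.

Section SubSigmaAlgebra.
Variables (G : set_system T) (Gm : G `<=` measurable) (sG : sigma_algebra setT G).

Lemma adapted_measurable X : adapted G X -> measurable_fun setT X.
Proof. by move=> aX _ B mB; rewrite setTI; apply: Gm; exact: aX. Qed.

Lemma in_L2_L2 X : in_L2 P G X -> L2 X.
Proof. by move=> [aX fX]; apply/L2P; split => //; exact: adapted_measurable. Qed.

Lemma in_L2E X : adapted G X -> L2 X -> in_L2 P G X.
Proof. by move=> aX /L2P[]. Qed.

(** Reads [adapted] as measurability on the type whose sigma-algebra is [G], so that the usual
    closure properties of measurable functions apply to sub-sigma-algebras. *)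
Lemma adaptedP X : adapted G X <-> measurable_fun setT (X : g_sigma_algebraType G -> R).
Proof.
rewrite /measurable_fun; split=> [aX _ B mB|mX B mB].
  by rewrite setTI (measurable_g_measurableTypeE sG); exact: aX.
by have := mX measurableT B mB; rewrite setTI (measurable_g_measurableTypeE sG).
Qed.

Lemma adapted_cst (c : R) : adapted G (fun=> c).
Proof. by apply/adaptedP; exact: measurable_cst. Qed.

Lemma adaptedD X Y : adapted G X -> adapted G Y -> adapted G (fun w => X w + Y w).
Proof. by move=> /adaptedP aX /adaptedP aY; apply/adaptedP; exact: measurable_funD. Qed.

Lemma adaptedM X Y : adapted G X -> adapted G Y -> adapted G (fun w => X w * Y w).
Proof. by move=> /adaptedP aX /adaptedP aY; apply/adaptedP; exact: measurable_funM. Qed.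

Lemma adaptedZ (c : R) X : adapted G X -> adapted G (fun w => c * X w).
Proof. by move=> aX; apply: adaptedM => //; exact: adapted_cst. Qed.

Lemma adaptedB X Y : adapted G X -> adapted G Y -> adapted G (fun w => X w - Y w).
Proof. by move=> /adaptedP aX /adaptedP aY; apply/adaptedP; exact: measurable_funB. Qed.

Lemma adapted_sum (I : Type) (r : seq I) (p : pred I) (X : I -> T -> R) :
  (forall i, p i -> adapted G (X i)) -> adapted G (fun w => \sum_(i <- r | p i) X i w).
Proof.
move=> aX; elim: r => [|i r IH].
  rewrite (_ : (fun w => _) = fun=> 0); first exact: adapted_cst.
  by apply/funext => w; rewrite big_nil.
have [pi|pi] := boolP (p i).
  rewrite (_ : (fun w => _) = (fun w => X i w + \sum_(i <- r | p i) X i w)).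
    by apply: adaptedD => //; exact: aX.
  by apply/funext => w; rewrite big_cons pi.
rewrite (_ : (fun w => _) = (fun w => \sum_(i <- r | p i) X i w)) => [//|].
by apply/funext => w; rewrite big_cons (negbTE pi).
Qed.

Section Convergence.
Context {I : Type} (Phi : set_system I) {FPhi : ProperFilter Phi}.

(** Replaces the extended-real norm by the real quadratic form [sqnorm], in which all later
    estimates are made. *)
Lemma L2_cvgP (X : I -> T -> R) Y : in_L2 P G Y -> (forall i, L2 (X i)) ->
  L2_cvg P G Phi X Y <-> sqnorm (fun w => X i w - Y w) @[i --> Phi] --> 0.
Proof.
move=> hY hX; have hXY i : L2 (fun w => X i w - Y w) by apply: L2B => //; exact: in_L2_L2.
rewrite /L2_cvg.
have -> : (fun i => 'N[P]_2%:E[EFin \o (fun w => (X i w - Y w)%R)]%E) =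
    (fun i => (Num.sqrt (sqnorm (fun w => X i w - Y w)))%:E).
  by apply/funext => i; exact: Lnorm2E (hXY i).
split=> [[_ /fine_cvgP[_ /= h]]|h].
  have : (Num.sqrt (sqnorm (fun w => X i w - Y w))) ^+ 2 @[i --> Phi] --> (0 ^+ 2 : R).
    by rewrite [X in _ --> X]expr2; under eq_fun do rewrite expr2; apply: cvgM.
  rewrite expr0n /=; apply: cvg_trans; apply: near_eq_cvg; near=> i.
  by rewrite sqr_sqrtr// sqnorm_ge0.
split => //; apply: cvg_EFin; first by near=> i.
rewrite -[X in _ --> X](sqrtr0 R).
by apply: (cvg_comp _ _ h); exact: sqrt_continuous.
Unshelve. all: by end_near. Qed.

Lemma L2_cvg_inner (X : I -> T -> R) Y W : (forall i, L2 (X i)) -> L2 W ->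
  L2_cvg P G Phi X Y -> inner (X i) W @[i --> Phi] --> inner Y W.
Proof.
move=> hX hW cX; have Y2 := in_L2_L2 cX.1.
have /(L2_cvgP cX.1 hX).1 h := cX.
suff : inner (fun w => X i w - Y w) W @[i --> Phi] --> 0.
  under eq_fun do rewrite innerBl//.
  by move/subr_cvg0.
suff : (inner (fun w => X i w - Y w) W) ^+ 2 @[i --> Phi] --> 0.
  move=> c; apply/norm_cvg0P.
  rewrite -[X in _ --> X](sqrtr0 R).
  under eq_fun do rewrite -sqrtr_sqr.
  by apply: (cvg_comp _ _ c); exact: sqrt_continuous.
apply: (@squeeze_cvgr _ _ _ _ (fun=> 0) (fun i => sqnorm (fun w => X i w - Y w) * sqnorm W)).
- by near=> i; rewrite sqr_ge0/= cauchy_schwarz// L2B.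
- exact: cvg_cst.
- by rewrite -[X in _ --> X](mul0r (sqnorm W)); apply: cvgMl.
Unshelve. all: by end_near. Qed.

Lemma L2_cvg_unique (X : I -> T -> R) Y Z : (forall i, L2 (X i)) ->
  L2_cvg P G Phi X Y -> L2_cvg P G Phi X Z -> sqnorm (fun w => Y w - Z w) = 0.
Proof.
move=> hX cY cZ; have Y2 := in_L2_L2 cY.1; have Z2 := in_L2_L2 cZ.1.
have YZ := L2B Y2 Z2.
rewrite /sqnorm innerBl//.
have := L2_cvg_inner hX YZ cY; have := L2_cvg_inner hX YZ cZ.
by move=> /(cvg_unique _)/[apply] ->//; rewrite subrr.
Qed.

(** Serves to pass from the sum of a series to the variable that it should represent, from which it
    may differ on a null set. *)
Lemma L2_cvg_ae (X : I -> T -> R) Y Z : (forall i, L2 (X i)) -> in_L2 P G Z ->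
  sqnorm (fun w => Y w - Z w) = 0 -> L2_cvg P G Phi X Y -> L2_cvg P G Phi X Z.
Proof.
move=> hX hZ YZ cY; have Y2 := in_L2_L2 cY.1; have Z2 := in_L2_L2 hZ.
apply/(L2_cvgP hZ hX); have /(L2_cvgP cY.1 hX).1 := cY.
move=> h; apply: (@squeeze_cvgr _ _ _ _ (fun=> 0)
  (fun i => 2 * sqnorm (fun w => X i w - Y w) + 2 * sqnorm (fun w => Y w - Z w))).
- by near=> i; rewrite sqnorm_ge0/= sqnorm_triangle.
- exact: cvg_cst.
- rewrite YZ -[X in _ --> X](addr0 0); apply: cvgD; last by rewrite mulr0; exact: cvg_cst.
  by rewrite -[X in _ --> X](mulr0 2); apply: cvgMr.
Unshelve. all: by end_near. Qed.

Lemma L2_limP (X : I -> T -> R) : (exists Y, L2_cvg P G Phi X Y) ->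
  L2_cvg P G Phi X (L2_lim P G Phi X).
Proof. by move=> exY; exact: (xgetPex (cst 0) exY). Qed.

End Convergence.

End SubSigmaAlgebra.
End InnerProduct.

(** * Completeness of $L^2$ and unordered sums of orthogonal terms *)

Section RieszFischer.
Context {d : measure_display} {T : measurableType d} {R : realType}.
Variable P : probability T R.
Variables (G : set_system T) (Gm : G `<=` measurable) (sG : sigma_algebra setT G).
Implicit Types X Y Z W : T -> R.

Local Notation L2 := (L2 P).
Local Notation sqnorm := (sqnorm P).
Local Notation inner := (inner P).

Lemma mean_norm_le X : L2 X -> mean P (fun w => `|X w|) <= Num.sqrt (sqnorm X).
Proof.
move=> hX; have nX : L2 (fun w => `|X w|).
  apply: L2_sqr_integrable; first exact: measurableT_comp (L2_measurable hX).
  have := Lfun2_integrable_sqr hX.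
  congr (_.-integrable _ _); apply/funext => w /=.
  by rewrite -normrX ger0_norm ?sqr_ge0.
have := cauchy_schwarz nX (L2_cst P 1).
rewrite inner_cst1 /(sqnorm (fun=> 1)) /inner.
have -> : mean P (fun=> 1 * 1 : R) = 1 by rewrite mean_cst mulr1.
rewrite mulr1; have -> : sqnorm (fun w => `|X w|) = sqnorm X.
  congr mean; apply/funext => w.
  by rewrite -normrM ger0_norm// -expr2 sqr_ge0.
rewrite -ler_sqrt ?sqnorm_ge0// sqrtr_sqr; apply: le_trans.
by rewrite ler_norm.
Qed.

Lemma sqnorm_integral X : L2 X -> (\int[P]_w (X w ^+ 2)%:E = (sqnorm X)%:E)%E.
Proof.
move=> hX; rewrite /sqnorm /inner /mean fineK ?expectation_fin_num ?L2_mul// unlock.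
by apply: eq_integral => w _ /=; rewrite expr2.
Qed.

(** Squared norms below [4^-1 ^+ n] give $L^1$ norms below [2^-1 ^+ n]. The sum of the absolute
    increments then has integral at most 2, is almost surely finite, and the telescoping series
    converges absolutely. *)
Lemma L2_geometric_ae_cvg (S : nat -> T -> R) : (forall n, L2 (S n)) ->
  (forall n, sqnorm (fun w => S n w - S n.+1 w) <= 4^-1 ^+ n) ->
  {ae P, forall w, cvgn (fun n => S n w)}.
Proof.
move=> hS dS; pose D n w := `|S n w - S n.+1 w|.
have mD n : measurable_fun setT (D n).
  by apply: measurableT_comp => //; exact: L2_measurable (L2B (hS n) (hS n.+1)).
have iD n : (\int[P]_w (D n w)%:E <= (2^-1 ^+ n)%:E)%E.
  have dn := L2B (hS n) (hS n.+1).
  have -> : (\int[P]_w (D n w)%:E = (mean P (D n))%:E)%E.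
    rewrite /mean fineK; first by rewrite unlock.
    by apply: expectation_fin_num; apply: Lfun_norm; exact: L2_Lfun1.
  rewrite lee_fin; apply: (le_trans (mean_norm_le dn)).
  rewrite -(@ger0_norm _ (2^-1 ^+ n)) ?exprn_ge0// -sqrtr_sqr ler_sqrt.
    by apply: (le_trans (dS n)); rewrite -exprM mulnC exprM expr2 -invfM -natrM.
  by rewrite sqr_ge0.
have mDE n : measurable_fun setT (fun w => (D n w)%:E) by exact/measurable_EFinP.
have D0 n w : setT w -> (0 <= (D n w)%:E)%E by move=> _; rewrite lee_fin /D normr_ge0.
have fin : (\int[P]_w \sum_(n <oo) (D n w)%:E < +oo)%E.
  rewrite integral_nneseries//.
  have : (\sum_(n <oo) \int[P]_w (D n w)%:E <= \sum_(n <oo) ((2^-1 ^+ n)%:E : \bar R))%E.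
    by apply: lee_nneseries => // n _ _; apply: integral_ge0 => w /D0.
  move/le_lt_trans; apply.
  suff -> : (\sum_(n <oo) ((2^-1 ^+ n)%:E : \bar R) = (1 / (1 - 2^-1))%:E)%E by rewrite ltry.
  apply/cvg_lim => //; rewrite (_ : (fun n => _) = EFin \o series (geometric 1 2^-1)).
    apply: cvg_EFin; first exact: nearW.
    by apply: cvg_geometric_series; rewrite ger0_norm; lra.
  apply/funext => n; rewrite /series /= -sumEFin.
  by apply: eq_bigr => i _; rewrite mul1r.
have : P.-integrable setT (fun w => \sum_(n <oo) (D n w)%:E)%E.
  apply/integrableP; split.
    apply: (@ge0_emeasurable_sum _ _ _ _ (fun n w => (D n w)%:E) xpredT) => // k w _ _.
    exact: D0.
  apply: le_lt_trans fin; rewrite le_eqVlt; apply/orP; left; apply/eqP.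
  apply: eq_integral => w _; rewrite gee0_abs// nneseries_ge0// => n _ _.
  exact: D0.
move=> /(integrable_ae measurableT); apply: filterS => w /(_ I) fw.
have cD : cvgn (series (fun n => D n w)).
  apply: nnseries_is_cvg => [n|]; first exact: normr_ge0.
  have s0 : (0 <= \sum_(n <oo) (D n w)%:E)%E by apply: nneseries_ge0 => n _ _; exact: D0.
  by move: fw; rewrite ge0_fin_numE.
have E : (fun n => S n w - S 0%N w) = series (fun n => S n.+1 w - S n w).
  by apply/funext => n; rewrite /series /= telescope_sumr.
have c : cvgn (fun n => S n w - S 0%N w).
  rewrite E; apply: normed_cvg.
  rewrite (_ : [normed series _] = series (D^~ w))//.
  by congr series; apply/funext => n; rewrite /D /= distrC.
have := is_cvgD c (is_cvg_cst (S 0%N w)).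
rewrite (_ : _ + _ = S^~ w); first exact.
by apply/funext => n /=; rewrite !fctE subrK.
Qed.

Lemma limn_einf_le (u : nat -> \bar R) c : (forall n, (u n <= c)%E) -> (limn_einf u <= c)%E.
Proof.
move=> uc; rewrite limn_einf_lim; apply: lime_le; first exact: is_cvg_einfs.
apply: nearW => n; apply: le_trans (uc n).
by apply: ereal_inf_lbound; exists n => //=.
Qed.

(* Riesz-Fischer; the pointwise [limsup] is taken so that the limit is
   measurable with respect to [G] everywhere, not only almost everywhere. *)
Lemma L2_complete (S : nat -> T -> R) : (forall n, in_L2 P G (S n)) ->
  (forall n m, sqnorm (fun w => S n w - S (n + m)%N w) <= 4^-1 ^+ n) ->
  exists2 Y, in_L2 P G Y & forall n, sqnorm (fun w => S n w - Y w) <= 4^-1 ^+ n.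
Proof.
move=> inS dS; have hS n : L2 (S n) := in_L2_L2 Gm (inS n).
pose Y w := fine (limn_esup (fun n => (S n w)%:E)).
have aY : adapted G Y.
  apply/(adaptedP sG); apply: (@measurableT_comp _ _ _ _ _ _ fine).
    exact: fine_measurable.
  apply: measurable_fun_limn_esup => n; apply/measurable_EFinP.
  by apply/(adaptedP sG); exact: (inS n).1.
have mY := adapted_measurable Gm aY.
have dSY n : (\int[P]_w ((S n w - Y w) ^+ 2)%:E <= (4^-1 ^+ n)%:E)%E.
  pose g m w := ((S n w - S (n + m)%N w) ^+ 2)%:E.
  have mg m : measurable_fun setT (g m).
    apply/measurable_EFinP; apply: measurable_funX.
    exact: L2_measurable (L2B (hS n) (hS (n + m)%N)).
  have g0 m w : setT w -> (0 <= g m w)%E by move=> _; rewrite lee_fin sqr_ge0.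
  (* Fatou's lemma in [m]: almost surely [g m] tends to [(S n - Y) ^+ 2], while every [g m] has
     integral at most [4^-1 ^+ n]. *)
  have <- : (\int[P]_w limn_einf (g^~ w) = \int[P]_w ((S n w - Y w) ^+ 2)%:E)%E.
    apply: ae_eq_integral => //.
    - rewrite (_ : (fun w => limn_einf (g^~ w)) =
          (fun w => - limn_esup (fun m => - g m w))%E); last first.
        apply/funext => w; rewrite -[in RHS]limn_einfN.
        by congr limn_einf; apply/funext => m; rewrite -[LHS]oppeK.
      apply: measurableT_comp => //; apply: measurable_fun_limn_esup => m.
      exact: measurableT_comp.
    - apply/measurable_EFinP; apply: measurable_funX; apply: measurable_funB => //.
      exact: L2_measurable.
    have : {ae P, forall w, cvgn (fun n => S n w)}.
      by apply: L2_geometric_ae_cvg => // k; have := dS k 1%N; rewrite addn1.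
    apply: filterS => w cS _; have /cvg_limn_einf_sup[_ supE] :
        (S k w)%:E @[k --> \oo] --> (limn (fun k => S k w))%:E.
      by apply: cvg_EFin => //; apply: nearW.
    have YE : Y w = limn (fun k => S k w) by rewrite /Y supE.
    have cSn : S (n + m)%N w @[m --> \oo] --> limn (fun k => S k w).
      have := cS; rewrite -[X in X -> _]/(S^~ w @ \oo --> limn (S^~ w)).
      rewrite -(cvg_shiftn n); apply: cvg_trans; apply: near_eq_cvg.
      by apply: nearW => m /=; rewrite addnC.
    have : g m w @[m --> \oo] --> ((S n w - Y w) ^+ 2)%:E.
      apply: cvg_EFin; first exact: nearW.
      have cB : S n w - S (n + m)%N w @[m --> \oo] --> S n w - limn (fun k => S k w).
        by apply: cvgB => //; exact: cvg_cst.
      by rewrite YE expr2; apply: cvg_trans (cvgM cB cB).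
    by move/cvg_limn_einf_sup => [].
  apply: (le_trans (fatou P measurableT mg g0)).
  apply: limn_einf_le => m; rewrite sqnorm_integral ?lee_fin//.
  exact: L2B.
have Y2 : L2 Y.
  have : L2 (fun w => S 0%N w - (S 0%N w - Y w)).
    apply: L2B => //; apply: L2_sqr_integrable.
      by apply: measurable_funB => //; exact: L2_measurable.
    apply/integrableP; split.
      apply/measurable_EFinP; apply: measurable_funX; apply: measurable_funB => //.
      exact: L2_measurable.
    under eq_integral do rewrite gee0_abs ?lee_fin ?sqr_ge0//.
    by apply: le_lt_trans (dSY 0%N) _; rewrite ltry.
  by apply: eq_L2 => w; rewrite subKr.
exists Y; first exact: in_L2E.
by move=> n; rewrite -lee_fin -sqnorm_integral//; exact: L2B.
Qed.

Section OrthogonalSeries.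
Context {I : choiceType}.
Variables (A : set I) (psi : I -> T -> R).
Hypothesis psi_in : forall i, A i -> in_L2 P G (psi i).
Hypothesis psi_orth : forall i j, A i -> A j -> i != j -> inner (psi i) (psi j) = 0.

Let psi2 i : i \in A -> L2 (psi i).
Proof. by move=> /set_mem /psi_in; exact: in_L2_L2. Qed.

Lemma L2_partial_sum J : L2 (partial_sum A psi J).
Proof. exact: L2_sum. Qed.

Lemma in_L2_partial_sum J : in_L2 P G (partial_sum A psi J).
Proof.
apply: in_L2E; last exact: L2_partial_sum.
by apply: adapted_sum => // i /set_mem /psi_in [].
Qed.

Lemma inner_partial_sum i K : A i ->
  inner (psi i) (partial_sum A psi K) = if i \in K then sqnorm (psi i) else 0.
Proof.
move=> Ai; have hi := psi2 (mem_set Ai).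
rewrite innerC inner_suml//.
case: ifPn => iK; last first.
  rewrite big_seq_cond big1// => j /andP[jK /set_mem Aj].
  by apply: psi_orth => //; apply: contraNneq iK => <-.
rewrite big_mkcond (bigD1_seq i) ?fset_uniq//= mem_set// big1 ?addr0// => j ji.
by case: ifPn => // /set_mem Aj; exact: psi_orth.
Qed.

Lemma inner_partial_sum_subset J K : (J `<=` K)%fset ->
  inner (partial_sum A psi J) (partial_sum A psi K) =
  \sum_(i <- J | i \in A) sqnorm (psi i).
Proof.
move=> JK; rewrite inner_suml//; last exact: L2_partial_sum.
rewrite big_seq_cond [RHS]big_seq_cond; apply: eq_bigr => i /andP[iJ /set_mem Ai].
by rewrite inner_partial_sum// (fsubsetP JK).
Qed.

Lemma sqnorm_partial_sum_diff J K : (J `<=` K)%fset ->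
  sqnorm (fun w => partial_sum A psi J w - partial_sum A psi K w) =
  \sum_(i <- K | i \in A) sqnorm (psi i) - \sum_(i <- J | i \in A) sqnorm (psi i).
Proof.
move=> JK; rewrite sqnormB; [|exact: L2_partial_sum..].
by rewrite /sqnorm !inner_partial_sum_subset// /sqnorm; ring.
Qed.

(** The filter of finite sets is reduced to a sequence. The finite set [K n] brings the sum of the
    squared norms within [4^-1 ^+ n] of its supremum, and [J n] is the union of [K 0, ..., K n]; by
    orthogonality any larger finite set changes the partial sum by at most [4^-1 ^+ n] in squared
    norm. *)
Lemma orthogonal_series_cvg M :
  (forall J : {fset I}, \sum_(i <- J | i \in A) sqnorm (psi i) <= M) ->
  exists S, L2_cvg P G summability.totally (partial_sum A psi) S.
Proof.
move=> bM; pose N (J : {fset I}) := \sum_(i <- J | i \in A) sqnorm (psi i).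
have supN : has_sup (range N).
  by split; [exists (N fset0), fset0|exists M => _ [J _ <-]; exact: bM].
pose s := sup (range N).
have Ns J : N J <= s by apply: sup_upper_bound => //; exists J.
have /choice[K KP] n : exists K, s - 4^-1 ^+ n < N K.
  have e0 : 0 < (4^-1 : R) ^+ n by rewrite exprn_gt0.
  by have [_ [J _ <-]] := sup_adherent e0 supN; exists J.
pose J n := (\bigcup_(k <- iota 0 n.+1) K k)%fset.
have KJ k n : (k <= n)%N -> (K k `<=` J n)%fset.
  by move=> kn; apply: bigfcup_sup => //; rewrite mem_iota.
have JJ n m : (J n `<=` J (n + m)%N)%fset.
  apply/bigfcupsP => k; rewrite mem_iota => /andP[_ kn] _.
  by apply: KJ; rewrite (leq_trans _ (leq_addr _ _)).
have NN (B C : {fset I}) : (B `<=` C)%fset -> N B <= N C.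
  move=> BC; rewrite -subr_ge0 -sqnorm_partial_sum_diff//; exact: sqnorm_ge0.
have Jd n B : (J n `<=` B)%fset ->
    sqnorm (fun w => partial_sum A psi (J n) w - partial_sum A psi B w) <= 4^-1 ^+ n.
  move=> nB; rewrite sqnorm_partial_sum_diff// -/(N _) -/(N _).
  have := KP n; have := Ns B; have := NN _ _ (KJ n n (leqnn n)); lra.
have [Y inY dY] := L2_complete (fun n => in_L2_partial_sum (J n))
  (fun n m => Jd n (J (n + m)%N) (JJ n m)).
exists Y; apply/(L2_cvgP Gm inY L2_partial_sum).
apply/cvgrPdist_lt => e e0.
(* The factor 4 is 2 + 2: [sqnorm_triangle] through the partial sum over [J n], both terms being at
   most [4^-1 ^+ n]. *)
have [n ne] : exists n, 4 * (4^-1 : R) ^+ n < e.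
  have : geometric 4 (4^-1 : R) n @[n --> \oo] --> 0.
    by apply: cvg_geometric; rewrite ger0_norm//; lra.
  move/cvgrPdist_lt => /(_ e e0) [n _ /(_ n (leqnn n))] /=.
  by rewrite sub0r normrN ger0_norm ?mulr_ge0 ?exprn_ge0//; exists n.
exists (J n) => // B /= nB; rewrite sub0r normrN ger0_norm ?sqnorm_ge0//.
have Y2 := in_L2_L2 Gm inY.
apply: le_lt_trans ne.
apply: (le_trans (sqnorm_triangle (L2_partial_sum B) (L2_partial_sum (J n)) Y2)).
have := dY n; have := Jd n B nB; rewrite sqnormBC; lra.
Qed.

(** The hypothesis says that [psi i] is itself the projection of [F] on its line. In this form there
    is no division by the norm of [psi i], which may be 0. *)
Lemma bessel F : L2 F -> (forall i, A i -> inner F (psi i) = sqnorm (psi i)) ->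
  forall J : {fset I}, \sum_(i <- J | i \in A) sqnorm (psi i) <= sqnorm F.
Proof.
move=> hF Fpsi J; have hJ := L2_partial_sum J.
have := sqnorm_ge0 P (fun w => F w - partial_sum A psi J w).
rewrite sqnormB// {2}/sqnorm inner_partial_sum_subset//.
rewrite innerC inner_suml// (eq_bigr (fun i => sqnorm (psi i))); first by lra.
by move=> i /set_mem Ai; rewrite innerC Fpsi.
Qed.

Lemma inner_series0 S W : L2_cvg P G summability.totally (partial_sum A psi) S ->
  L2 W -> (forall i, A i -> inner (psi i) W = 0) -> inner S W = 0.
Proof.
move=> cS hW W0.
have /cvg_unique :
    inner (partial_sum A psi J) W @[J --> summability.totally] --> inner S W.
  by apply: (L2_cvg_inner Gm _ hW cS) => J; exact: L2_partial_sum.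
apply => //; apply: cvg_near_cst; apply: nearW => J.
by rewrite inner_suml// big1// => i /set_mem; exact: W0.
Qed.

(** All partial sums over finite sets containing [i] have the same inner product with [W], and the
    inner product is continuous. *)
Lemma inner_series1 i S W : L2_cvg P G summability.totally (partial_sum A psi) S ->
  L2 W -> A i -> (forall j, A j -> j != i -> inner (psi j) W = 0) ->
  inner S W = inner (psi i) W.
Proof.
move=> cS hW Ai W0.
have /cvg_unique :
    inner (partial_sum A psi J) W @[J --> summability.totally] --> inner S W.
  by apply: (L2_cvg_inner Gm _ hW cS) => J; exact: L2_partial_sum.
apply => //.
apply: cvg_near_cst; exists [fset i]%fset => // J; rewrite /= fsub1set => iJ.
rewrite inner_suml// big_mkcond (bigD1_seq i) ?fset_uniq//= mem_set// big1 ?addr0// => j ji.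
by case: ifPn => // /set_mem Aj; exact: W0.
Qed.

End OrthogonalSeries.

Lemma ae0_L2 X : measurable_fun setT X -> ae_eq P setT X (cst 0) ->
  L2 X /\ sqnorm X = 0.
Proof.
move=> mX X0.
have mX2 : measurable_fun setT (fun w => (X w ^+ 2)%:E).
  by apply/measurable_EFinP; exact: measurable_funX.
have i0 : (\int[P]_w (X w ^+ 2)%:E = 0)%E.
  rewrite (ae_eq_integral (cst 0%E) _ measurableT mX2)//; first exact: integral0.
  by move: X0; apply: filterS => w /= Xw h; rewrite (Xw h) expr0n.
have X2 : L2 X.
  apply: L2_sqr_integrable => //; apply/integrableP; split => //.
  under eq_integral do rewrite gee0_abs ?lee_fin ?sqr_ge0//.
  by rewrite i0 ltry.
by split => //; have := sqnorm_integral X2; rewrite i0 => -[].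
Qed.

(** Testing on the event [H >= 0] and on its complement gives $\mathbf E|H|=0$. Only integrability
    is asked of [H], because a version of a conditional expectation is at first known to be no more
    than integrable. *)
Lemma adapted_ae0 H : adapted G H -> H \in Lfun P 1 ->
  (forall A, G A -> mean P (fun w => H w * \1_A w) = 0) -> ae_eq P setT H (cst 0).
Proof.
move=> aH H1 H0.
pose A := H @^-1` `[0, +oo[.
have GA : G A by exact: aH.
have GC : G (~` A) by case: sG => _ GD _; rewrite -setTD; exact: GD.
have mA := Gm GA; have mC := Gm GC.
have int B : measurable B -> (fun w => H w * \1_B w) \in Lfun P 1.
  move=> mB; apply/Lfun1_integrable; move/Lfun1_integrable: H1; apply: le_integrable => //.
    by apply/measurable_EFinP; apply: measurable_funM;
      [exact: (adapted_measurable Gm aH)|exact: measurable_indic].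
  move=> w _ /=; rewrite lee_fin normrM indicE.
  by case: (w \in B); rewrite ?normr1 ?mulr1 ?normr0 ?mulr0.
have nH : mean P (fun w => `|H w|) = 0.
  rewrite (_ : (fun w => `|H w|) = (fun w => H w * \1_A w + -1 * (H w * \1_(~` A) w))).
    rewrite meanD ?int//; last first.
      have := Lfun_scale (-1) (lexx 1) (int _ mC).
      rewrite (_ : _ \o* _ = (fun w => -1 * (H w * \1_(~` A) w)))//.
      by apply/funext => w; exact: mulrC.
    by rewrite meanZ ?int// !H0// mulr0 addr0.
  apply/funext => w; rewrite !indicE in_setC.
  have [/set_mem|/negP wA] := boolP (w \in A).
    rewrite /A /= in_itv/= andbT => Hw; by rewrite ger0_norm//= mulr1 mulr0 mulr0 addr0.
  have Hw : H w < 0.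
    by rewrite ltNge; apply/negP => Hw; apply: wA; rewrite inE /A /= in_itv/= Hw.
  by rewrite ltr0_norm//= mulr0 mulr1 add0r mulN1r.
have mH := adapted_measurable Gm aH.
have i0 : (\int[P]_w `|(EFin \o H) w| = 0)%E.
  have : ('E_P[Num.norm \o H] = 0)%E.
    by rewrite -[LHS]fineK ?expectation_fin_num//; [congr EFin|exact: Lfun_norm].
  by rewrite unlock.
have /(ae_eq_integral_abs P measurableT) [/(_ i0) + _] : measurable_fun setT (EFin \o H).
  exact/measurable_EFinP.
by apply: filterS => w /= h /h[].
Qed.

Lemma L2_cvg_shift {I : Type} (Phi : set_system I) (X : I -> T -> R) F c :
  in_L2 P G F -> L2_cvg P G Phi X (fun w => F w - c) ->
  L2_cvg P G Phi (fun i w => c + X i w) F.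
Proof.
move=> inF [_ h]; split => //; move: h.
rewrite (_ : (fun i => 'N[P]_2%:E[EFin \o (fun w => (c + X i w - F w)%R)]%E) =
  (fun i => 'N[P]_2%:E[EFin \o (fun w => (X i w - (F w - c))%R)]%E))//.
apply/funext => i; congr ('N[P]_2%:E[_]%E); apply/funext => w /=.
by congr EFin; ring.
Qed.

(** Initial segments of the integers eventually contain any given finite set, so unordered
    convergence implies convergence of the ordered partial sums. *)
Lemma L2_cvg_totally_seq m (psi : nat -> T -> R) S :
  L2_cvg P G summability.totally (partial_sum [set n | (m <= n)%N] psi) S ->
  L2_cvg P G \oo (fun N w => \sum_(m <= n < N) psi n w) S.
Proof.
move=> [inS h]; split => //.
pose J N := [fset n in iota 0 N]%fset.
have cJ : J N @[N --> \oo] --> summability.totally.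
  move=> B [K _ KB]; exists (\max_(k <- K) k.+1)%N => // N /= KN; apply: KB.
  apply/fsubsetP => k kK; rewrite !inE/= mem_iota add0n.
  by apply: leq_trans KN; exact: (@leq_bigmax_seq _ _ xpredT (fun k => k.+1)).
have := cvg_comp _ _ cJ h.
apply: cvg_trans; apply: near_eq_cvg; apply: nearW => N /=.
congr ('N[P]_2%:E[_]%E); apply/funext => w /=; congr (EFin (_ - _)).
rewrite /partial_sum (perm_big (iota 0 N)) /=; last first.
  by apply: uniq_perm; rewrite ?fset_uniq ?iota_uniq// => k; rewrite !inE.
rewrite -{1}(subn0 N) -/(index_iota 0 N) (big_nat_widenl m 0)//.
by apply: eq_bigl => k; apply/idP/idP => [/set_mem/= ->|/= mk]; rewrite ?mem_set.
Qed.

End RieszFischer.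

(** * The marked binomial process *)

Section MarkedBinomialLaw.
Context {d : measure_display} {T : measurableType d} {R : realType}.
Variable P : probability T R.
Variables (lam : R) (E : set int) (Q : probability int R).
Variables (xi : nat -> {RV P >-> nat}) (V : nat -> {RV P >-> int}).
Hypothesis process : is_marked_binomial xi V lam E Q.

Local Notation arrival := (arrival xi).
Local Notation eta := (marked_process xi V).
Local Notation XX := (XX E).

Lemma arrival0 w : arrival 0 w = xi 0%N w.
Proof. by rewrite /arrival big_ord_recl big_ord0 addn0. Qed.

Lemma arrivalS i w : arrival i.+1 w = (arrival i w + xi i.+1 w)%N.
Proof. by rewrite /arrival big_ord_recr. Qed.

Lemma arrival_lt i j w : (i < j)%N -> (arrival i w < arrival j w)%N.
Proof.
elim: j => // j IH; rewrite ltnS arrivalS leq_eqVlt => /predU1P[->|/IH].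
  by rewrite -[X in (X < _)%N]addn0 ltn_add2l (xi_gt0 process).
by move/leq_trans; apply; exact: leq_addr.
Qed.

Lemma arrival_inj i j w : arrival i w = arrival j w -> i = j.
Proof.
move=> h; case: (ltngtP i j) => // /(arrival_lt w); by rewrite h ltnn.
Qed.

Lemma leq_arrival i w : (i < arrival i w)%N.
Proof.
elim: i => [|i IH]; first by rewrite arrival0 (xi_gt0 process).
by apply: leq_ltn_trans IH _; exact: arrival_lt.
Qed.

Lemma measurable_arrival i : measurable_fun setT (arrival i).
Proof.
elim: i => [|i IH].
  by rewrite (_ : arrival 0 = xi 0%N)//; apply/funext => w; rewrite arrival0.
rewrite (_ : arrival i.+1 = fun w => (arrival i w + xi i.+1 w)%N).
  exact: measurable_fun_addn.
by apply/funext => w; rewrite arrivalS.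
Qed.

(** The event $x\in\eta$, expressed by arrivals and marks instead of the random measure. *)
Definition hit (x : point_tm) : set T :=
  [set w | exists2 i, arrival i w = x.1 & V i w = x.2].

Lemma measurable_hit x : measurable (hit x).
Proof.
rewrite (_ : hit x = \bigcup_i ((arrival i @^-1` [set x.1]) `&` (V i @^-1` [set x.2]))).
  apply: bigcupT_measurable => i; apply: measurableI.
    by rewrite -[X in measurable X]setTI; apply: measurable_arrival.
  by rewrite -[X in measurable X]setTI; apply: (measurable_funPT (V i)).
apply/seteqP; split => w /= => [[i h1 h2]|[i _ [h1 h2]]]; exists i => //.
Qed.

Lemma hit_disjoint t k l : k <> l -> hit (t, k) `&` hit (t, l) = set0.
Proof.
move=> kl; apply/seteqP; split => // w /= [[i /= hi Vi] [j /= hj Vj]]; apply: kl.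
by rewrite -Vi -Vj; congr (V _ w); apply: (@arrival_inj _ _ w); rewrite hi.
Qed.

Lemma etaE w A : eta w A = (\sum_(i <oo) ((arrival i w, V i w) \in A)%:R%:E)%E.
Proof. by rewrite /marked_process /= /mseries; under eq_eseriesr do rewrite /= diracE. Qed.

(** Arrival times increase strictly, so at most one index contributes to the mass of a singleton. *)
Lemma eta_set1 x w : eta w [set x] = (\1_(hit x) w : R)%:E.
Proof.
rewrite etaE indicE nneseries_esumT; last by move=> n; rewrite lee_fin.
have [[i ai Vi]|nx] := asboolP (hit x w); last first.
  rewrite memNset// esum1// => i _; rewrite memNset//= => xE; apply: nx.
  by exists i; rewrite -xE.
rewrite mem_set; last by exists i.
rewrite -(@esum_set1 _ _ i (fun=> 1%:E))// [RHS]esum_mkcond.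
apply: eq_esum => j _; case: ifPn => [/set_mem /= ->|].
  by rewrite mem_set//= ai Vi -surjective_pairing.
move=> /negP ij; rewrite memNset//= => xE; apply: ij; apply/mem_set => /=.
by apply: (@arrival_inj _ _ w); rewrite ai -xE.
Qed.

Lemma eta_gt0 x : [set w | (0 < eta w [set x])%E] = hit x.
Proof.
apply/seteqP; split => w /=; rewrite eta_set1 indicE lte_fin.
  by have [/set_mem//|_] := boolP (w \in hit x); rewrite ltxx.
by move=> h; rewrite mem_set.
Qed.

(** One family contains all the sigma-algebras of the proof: [U = setT] gives [sigma_eta], the times
    [s <= t] give [filtration t], and the times [s < t] give the strict past. *)
Definition hit_sigma (U : set nat) : set_system T :=
  <<s [set hit x | x in [set x | XX x /\ U x.1]] >>.

Lemma hit_sigma_algebra U : sigma_algebra setT (hit_sigma U).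
Proof. exact: smallest_sigma_algebra. Qed.

Lemma hit_sigma_measurable U : hit_sigma U `<=` measurable.
Proof.
apply: smallest_sub; first exact: sigma_algebra_measurable.
by move=> _ [x _ <-]; exact: measurable_hit.
Qed.

Lemma hit_sigma_sub U U' : U `<=` U' -> hit_sigma U `<=` hit_sigma U'.
Proof.
move=> UU; apply: smallest_sub; first exact: hit_sigma_algebra.
by move=> _ [x [Xx Ux] <-]; apply: sub_sigma_algebra; exists x => //; split => //; exact: UU.
Qed.

Lemma hit_sigma_hit U x : XX x -> U x.1 -> hit_sigma U (hit x).
Proof. by move=> Xx Ux; apply: sub_sigma_algebra; exists x. Qed.

(** There are countably many points: [A] is the disjoint union of the sets [F n] of its points of
    code [n], each empty or a singleton, so that the mass of [A] is a series of indicators of events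
    [hit x]. *)
Lemma hit_sigma_eta (U : set nat) (A : set point_tm) (B : set \bar R) :
  A `<=` XX -> (forall x, A x -> U x.1) -> measurable B ->
  hit_sigma U ((fun w => eta w A) @^-1` B).
Proof.
move=> AX AU mB.
pose F (n : nat) : set point_tm := [set x | A x /\ choice.pickle x = n].
have F1 n : F n = set0 \/ exists2 x, A x & F n = [set x].
  have [->|/set0P[x [Ax xn]]] := eqVneq (F n) set0; [by left|right; exists x => //].
  apply/seteqP; split => y /=; last by move=> ->.
  by move=> [_ yn]; apply: (pcan_inj (@choice.pickleK _)); rewrite /= yn.
have mF n : measurable (F n).
  have [->//|[x _ ->]] := F1 n.
  rewrite (_ : [set x] = [set x.1] `*` [set x.2]); first exact: measurableX.
  by apply/seteqP; split => -[a b] /=; [move=> <-|move=> [-> ->]; case: x].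
have tF : trivIset setT F by move=> m n _ _ [x [[_ /= <-] [_ /= <-]]].
have AE : A = \bigcup_n F n.
  apply/seteqP; split => x; last by move=> [n _ []].
  by move=> Ax; exists (choice.pickle x) => //; split.
have -> : (fun w => eta w A) = (fun w => \sum_(n <oo) eta w (F n))%E.
  by apply/funext => w; rewrite {1}AE measure_semi_bigcup//; exact: bigcupT_measurable.
suff : measurable_fun setT ((fun w => \sum_(n <oo) eta w (F n))%E :
    g_sigma_algebraType (hit_sigma U) -> \bar R).
  move=> /(_ measurableT B mB); rewrite setTI.
  by rewrite (measurable_g_measurableTypeE (@hit_sigma_algebra U)).
apply: (@ge0_emeasurable_sum _ (g_sigma_algebraType (hit_sigma U)) R setT
  (fun n w => eta w (F n)) xpredT) => // n _.
have [->|[x Ax ->]] := F1 n.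
  by rewrite (_ : (fun w => _) = cst 0%E)//; apply/funext => w; rewrite measure0.
rewrite (_ : (fun w => _) = fun w => (\1_(hit x) w)%:E).
  apply/measurable_EFinP; apply: measurable_indic.
  rewrite (measurable_g_measurableTypeE (@hit_sigma_algebra U)).
  by apply: hit_sigma_hit; [exact: AX|exact: AU].
by apply/funext => w; rewrite eta_set1.
Qed.

Lemma hit_preimage x : hit x = (fun w => eta w [set x]) @^-1` [set 1%E].
Proof.
apply/seteqP; split => w /=; rewrite eta_set1 indicE; first by move=> h; rewrite mem_set.
by have [/set_mem//|_ [] /eqP] := boolP (w \in hit x); rewrite eq_sym oner_eq0.
Qed.

Lemma sigma_etaE : sigma_eta E eta = hit_sigma setT.
Proof.
rewrite /sigma_eta /sigma_gen; apply/seteqP; split.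
  apply: smallest_sub; first exact: hit_sigma_algebra.
  move=> _ [A AX [B mB <-]]; rewrite setTI.
  exact: hit_sigma_eta.
apply: smallest_sub; first exact: smallest_sigma_algebra.
move=> _ [x [Xx _] <-]; apply: sub_sigma_algebra; exists [set x]; first by move=> _ ->.
by exists [set 1%E]; [exact: emeasurable_set1|rewrite setTI -hit_preimage].
Qed.

Lemma filtrationE t : filtration E eta t = hit_sigma [set s | (s <= t)%N].
Proof.
rewrite /filtration /sigma_gen; apply/seteqP; split.
  apply: smallest_sub; first exact: hit_sigma_algebra.
  move=> _ [x [Xx xt] [B mB <-]]; rewrite setTI.
  by apply: hit_sigma_eta => // _ ->.
apply: smallest_sub; first exact: smallest_sigma_algebra.
move=> _ [x [Xx xt] <-]; apply: sub_sigma_algebra; exists x => //.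
by exists [set 1%E]; [exact: emeasurable_set1|rewrite setTI -hit_preimage].
Qed.

(** * Independence of the points at one time from the strict past *)

Lemma xi_tail i g : P (xi i @^-1` [set m | (g < m)%N]) = ((1 - lam) ^+ g)%:E.
Proof.
have mx A : measurable (xi i @^-1` A).
  by rewrite -[X in measurable X]setTI; apply: (measurable_funPT (xi i)).
elim: g => [|g IH].
  rewrite expr0 -(probability_setT P); congr (P _); apply/seteqP; split => // w _ /=.
  exact: (xi_gt0 process).
have -> : xi i @^-1` [set m | (g.+1 < m)%N] =
    xi i @^-1` [set m | (g < m)%N] `\` xi i @^-1` [set g.+1].
  apply/seteqP; split => w /=.
    by move=> h; split; [exact: ltnW|move=> e; rewrite e ltnn in h].
  by move=> [h e]; rewrite ltn_neqAle h andbT; apply/eqP => e'; apply: e.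
rewrite measureD//; last by rewrite ltey_eq fin_num_measure.
rewrite setIidr; last by move=> w /= ->.
transitivity (((1 - lam) ^+ g)%:E - (lam * (1 - lam) ^+ g)%:E)%E.
  by congr (_ - _)%E; [exact: IH|exact: (xi_geometric process)].
by rewrite -EFinB; congr EFin; rewrite exprS; ring.
Qed.

(** The independence of times and marks is assumed for the arrivals; gaps are differences of
    successive arrivals and so inherit it. *)
Lemma xi_arrival_measurable i (C : set nat) : sigma_gen setT arrival (xi i @^-1` C).
Proof.
set G := sigma_gen setT arrival.
have sG : sigma_algebra setT G by exact: smallest_sigma_algebra.
have mA j : measurable_fun setT (arrival j : g_sigma_algebraType G -> nat).
  move=> _ B mB; rewrite (measurable_g_measurableTypeE sG).
  by apply: sub_sigma_algebra; exists j => //; exists B.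
suff /(_ measurableT C I) : measurable_fun setT (xi i : g_sigma_algebraType G -> nat).
  by rewrite setTI (measurable_g_measurableTypeE sG).
case: i => [|i].
  by have := mA 0%N; congr (measurable_fun _ _); apply/funext => w; rewrite arrival0.
have : measurable_fun setT (fun w : g_sigma_algebraType G => (arrival i.+1 w - arrival i w)%N).
  exact: measurable_fun_subn.
by congr (measurable_fun _ _); apply/funext => w; rewrite arrivalS addKn.
Qed.

Lemma sigma_gen_bigcap {d' : measure_display} {U : measurableType d'}
  (X : nat -> T -> U) (J : {fset nat}) (C : nat -> set T) :
  (forall i, i \in J -> sigma_gen setT X (C i)) ->
  sigma_gen setT X (\bigcap_(i in [set` J]) C i).
Proof.
move=> CX; set G := sigma_gen setT X.
have sG : sigma_algebra setT G by exact: smallest_sigma_algebra.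
have : measurable (\bigcap_(i in [set` J]) (C i : set (g_sigma_algebraType G))).
  apply: fin_bigcap_measurable => // i /= iJ.
  by rewrite (measurable_g_measurableTypeE sG); exact: CX.
by rewrite (measurable_g_measurableTypeE sG).
Qed.

Lemma joint_law (J : {fset nat}) (C : nat -> set nat) (D : nat -> set int) :
  P ((\bigcap_(i in [set` J]) xi i @^-1` C i) `&` (\bigcap_(i in [set` J]) V i @^-1` D i)) =
  (\prod_(i <- J) P (xi i @^-1` C i) * \prod_(i <- J) Q (D i))%E.
Proof.
rewrite (arrival_mark_indep process).
- rewrite (xi_indep process); last by move=> i _; exists (C i) => //; rewrite setTI.
  rewrite (mark_indep process); last by move=> i _; exists (D i) => //; rewrite setTI.
  by congr (_ * _)%E; apply: eq_bigr => i _; rewrite -(mark_law process i).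
- by apply: sigma_gen_bigcap => i _; exact: xi_arrival_measurable.
- apply: sigma_gen_bigcap => i _; apply: sub_sigma_algebra; exists i => //.
  by exists (D i) => //; rewrite setTI.
Qed.

Definition history n w : seq (nat * int) := [seq (xi i w, V i w) | i <- iota 0 n].

Definition total (c : seq (nat * int)) : nat := sumn (unzip1 c).

Lemma size_history n w : size (history n w) = n.
Proof. by rewrite size_map size_iota. Qed.

Lemma total_historyS n w : total (history n.+1 w) = arrival n w.
Proof.
rewrite /total /unzip1 -map_comp sumnE big_map /arrival.
by rewrite -(big_mkord xpredT (fun i => xi i w)) /index_iota subn0.
Qed.

Lemma arrival_history n w : arrival n w = (total (history n w) + xi n w)%N.
Proof. by case: n => [|n]; [rewrite arrival0|rewrite total_historyS arrivalS]. Qed.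

(* The cells are the atoms of the sigma-algebra of the events before time [t];
   [c] lists the gaps and the marks of the points before time [t]. *)
Definition cell t (c : seq (nat * int)) : set T :=
  [set w | history (size c) w = c /\ (total c < t <= total c + xi (size c) w)%N].

(** On the cell, [total c] is the time of the last arrival before [t], or 0 if there is none, and
    the next arrival is at [t] or later. *)
Lemma cell_arrival_lt t c i w : cell t c w -> (arrival i w < t)%N = (i < size c)%N.
Proof.
move=> [hc /andP[ct]]; rewrite -{1}hc -arrival_history => tc.
case: (ltnP i (size c)) => [ic|ci]; last first.
  apply/negbTE; rewrite -leqNgt; apply: leq_trans tc _.
  by move: ci; rewrite leq_eqVlt => /predU1P[->//|/(arrival_lt w)/ltnW].
apply: leq_ltn_trans ct; rewrite -hc; case: (size c) ic => // n.
rewrite total_historyS ltnS leq_eqVlt => /predU1P[->//|].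
by move/(arrival_lt w)/ltnW.
Qed.

Lemma cell_inj t c c' w : cell t c w -> cell t c' w -> c = c'.
Proof.
move=> hc hc'; have lt_size i : (i < size c)%N = (i < size c')%N.
  by rewrite -(cell_arrival_lt _ hc) (cell_arrival_lt _ hc').
have sE : size c = size c' by have := lt_size (size c); have := lt_size (size c'); lia.
by rewrite -hc.1 -hc'.1 sE.
Qed.

Lemma cell_cover t w : (0 < t)%N -> exists c, cell t c w.
Proof.
move=> t0; have ex : exists i, (t <= arrival i w)%N.
  by exists t; exact/ltnW/leq_arrival.
have [n tn nmin] := ex_minnP ex.
exists (history n w); split; rewrite size_history//.
rewrite -arrival_history tn andbT; case: n tn nmin => [//|n] _ nmin.
by rewrite total_historyS ltnNge; apply/negP => /nmin; rewrite ltnn.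
Qed.

Lemma cell_hit t c k w : cell t c w ->
  hit (t, k) w <-> xi (size c) w = (t - total c)%N /\ V (size c) w = k.
Proof.
move=> hc; have [e /andP[ct tc]] := hc.
have aE : arrival (size c) w = (total c + xi (size c) w)%N by rewrite arrival_history e.
split=> [[i /= ai Vi]|[xE VE]]; last by exists (size c) => //=; rewrite aE xE; lia.
have iE : i = size c.
  have := cell_arrival_lt i hc; rewrite ai ltnn => /esym/negbT; rewrite -leqNgt.
  rewrite leq_eqVlt => /predU1P[->//|/(arrival_lt w)]; rewrite ai aE; lia.
by subst i; split=> //; lia.
Qed.

Lemma history_law c (C : set nat) (D : set int) :
  P [set w | history (size c) w = c /\ C (xi (size c) w) /\ D (V (size c) w)] =
  (P [set w | history (size c) w = c] * (P (xi (size c) @^-1` C) * Q D))%E.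
Proof.
pose x0 : nat * int := (0%N, 0); set n := size c.
have hE w : history n w = c <->
    forall i, (i < n)%N -> xi i w = (nth x0 c i).1 /\ V i w = (nth x0 c i).2.
  split=> [hc i ic|h].
    by rewrite -[c]hc (nth_map 0%N) ?size_iota// nth_iota// add0n.
  apply: (@eq_from_nth _ x0); rewrite size_history// => i ic.
  by rewrite (nth_map 0%N) ?size_iota// nth_iota// add0n; have [-> ->] := h i ic; case: nth.
pose J m : {fset nat} := [fset i in iota 0 m]%fset.
have JE m i : (i \in J m) = (i < m)%N by rewrite !inE/= mem_iota add0n.
have JS (f : nat -> \bar R) m : (\prod_(i <- J m.+1) f i = \prod_(i <- J m) f i * f m)%E.
  have pJ l : perm_eq (J l) (iota 0 l).
    by apply: uniq_perm; rewrite ?fset_uniq ?iota_uniq// => i; rewrite JE mem_iota add0n.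
  by rewrite !(perm_big _ (pJ _)) -addn1 iotaD big_cat big_seq1.
(* [C'] and [D'] prescribe the first [n] gaps and marks exactly and put [C] and [D] at index [n].
   Both events become rectangles, to which [joint_law] applies. *)
pose C' i := if (i < n)%N then [set (nth x0 c i).1] else C.
pose D' i := if (i < n)%N then [set (nth x0 c i).2] else D.
have -> : [set w | history n w = c] =
    (\bigcap_(i in [set` J n]) xi i @^-1` C' i) `&` (\bigcap_(i in [set` J n]) V i @^-1` D' i).
  apply/seteqP; split => w /=.
    by move=> /hE h; split=> i /=; rewrite JE /C' /D' => ic; rewrite ic /=; have [] := h i ic.
  move=> [h1 h2]; apply/hE => i ic; have := h1 i; have := h2 i.
  by rewrite /= JE /C' /D' ic /=; split; auto.
have -> : [set w | history n w = c /\ C (xi n w) /\ D (V n w)] =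
    (\bigcap_(i in [set` J n.+1]) xi i @^-1` C' i) `&`
    (\bigcap_(i in [set` J n.+1]) V i @^-1` D' i).
  apply/seteqP; split => w /=.
    move=> [/hE h [hC hD]]; split=> i /=; rewrite JE ltnS leq_eqVlt /C' /D' => /predU1P[->|ic];
      rewrite ?ltnn ?ic//=; by have [] := h i ic.
  move=> [h1 h2]; split; last first.
    have := h1 n; have := h2 n.
    by rewrite /= JE ltnS leqnn /C' /D' ltnn; split; auto.
  apply/hE => i ic; have := h1 i; have := h2 i.
  by rewrite /= JE ltnS ltnW// /C' /D' ic /=; split; auto.
by rewrite !joint_law !JS /C' /D' ltnn muleACA.
Qed.

(** Lack of memory. With [g.+1 = t - total c], the cell asks the next gap to exceed [g], of
    probability $(1-\lambda)^g$, and a point at [t] asks it to equal [g.+1], of probability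
    $\lambda(1-\lambda)^g$; the quotient is $\lambda$. *)
Lemma cell_law t c k : (P (cell t c `&` hit (t, k)) = lam%:E * Q [set k] * P (cell t c))%E.
Proof.
have [ct|tc] := ltnP (total c) t; last first.
  rewrite (_ : cell t c = set0) ?set0I ?measure0 ?mule0//.
  by apply/seteqP; split => // w [_ /andP[]]; rewrite ltnNge tc.
have [g gE] : exists g, (t - total c)%N = g.+1 by exists (t - total c).-1; lia.
have -> : cell t c `&` hit (t, k) =
    [set w | history (size c) w = c /\ [set g.+1] (xi (size c) w) /\ [set k] (V (size c) w)].
  apply/seteqP; split => w /=.
    by move=> [hc]; rewrite (cell_hit k hc) gE => -[-> ->]; split => //; exact: hc.1.
  move=> [e [xE VE]]; have hc : cell t c w by split => //; rewrite ct xE; lia.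
  by split => //; rewrite (cell_hit k hc) gE.
have -> : cell t c =
    [set w | history (size c) w = c /\ [set m | (g < m)%N] (xi (size c) w) /\ setT (V (size c) w)].
  apply/seteqP; split => w /=.
    by move=> [hc /andP[_ tc]]; split => //; split => //; lia.
  by move=> [hc [gx _]]; split => //; rewrite ct; lia.
rewrite !history_law xi_tail probability_setT mule1.
rewrite (_ : P (xi (size c) @^-1` [set g.+1]) = (lam * (1 - lam) ^+ g)%:E); last first.
  exact: (xi_geometric process).
rewrite EFinM [RHS]muleCA; congr (_ * _)%E.
by rewrite -!muleA; congr (_ * _)%E; rewrite muleC.
Qed.

Lemma measurable_cell t c : measurable (cell t c).
Proof.
have mx i A : measurable (xi i @^-1` A).
  by rewrite -[X in measurable X]setTI; apply: (measurable_funPT (xi i)).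
have mV i A : measurable (V i @^-1` A).
  by rewrite -[X in measurable X]setTI; apply: (measurable_funPT (V i)).
rewrite (_ : cell t c = (\bigcap_(i in `I_(size c)) (xi i @^-1` [set (nth (0%N, 0 : int) c i).1] `&`
    V i @^-1` [set (nth (0%N, 0) c i).2])) `&`
    xi (size c) @^-1` [set m | (total c < t <= total c + m)%N]).
  apply: measurableI => //; apply: bigcap_measurableType => // i _; exact: measurableI.
apply/seteqP; split => w /= [h1 h2]; split => //.
  by move=> i /= ic; rewrite -h1 (nth_map 0%N) ?size_iota// nth_iota// add0n.
apply: (@eq_from_nth _ (0%N, 0 : int)); rewrite size_history// => i ic.
rewrite (nth_map 0%N) ?size_iota// nth_iota// add0n.
by have [/= -> ->] := h1 i ic; case: nth.
Qed.

(** The sets that do not separate two points of a cell form a sigma-algebra. It contains [hit x] for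
    [x.1 < t], because the outcomes of a cell share all gaps and marks up to the last arrival before
    [t]. *)
Lemma hit_sigma_cell t A c w w' : hit_sigma [set s | (s < t)%N] A ->
  cell t c w -> cell t c w' -> A w -> A w'.
Proof.
move=> hA; move: w w'.
suff : forall w w', cell t c w -> cell t c w' -> A w <-> A w'.
  by move=> h w w' cw cw'; have [] := h w w' cw cw'.
move: A hA; apply: smallest_sub.
  split=> [//|A hA w w' cw cw'|A hA w w' cw cw'].
    by have := hA w w' cw cw'; rewrite /setD /=; tauto.
  by split=> -[n _ An]; exists n => //; have [] := hA n w w' cw cw'; auto.
suff sub x w w' : (x.1 < t)%N -> cell t c w -> cell t c w' -> hit x w -> hit x w'.
  by move=> _ [x [_ /= xt] <-] w w' cw cw'; split; exact: sub.
move=> xt cw cw' [i ai Vi].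
have ic : (i < size c)%N by rewrite -(cell_arrival_lt i cw) ai.
have hE n : (n <= size c)%N -> history n w = history n w'.
  move=> nc; have := cw.1; rewrite -{2}cw'.1 => /(congr1 (take n)).
  by rewrite -!map_take !take_iota (minn_idPl nc).
have := hE _ ic; rewrite /history -addn1 iotaD !map_cat /= add0n.
move=> /eqP; rewrite eqseq_cat ?size_map// => /andP[/eqP hi /eqP [xE VE]].
exists i; last by rewrite -VE.
by rewrite arrival_history -xE /history -hi -ai arrival_history.
Qed.

(** The cells are indexed by lists, hence countable, and partition the space. Each is contained in
    [A] or disjoint from it, so that summing [cell_law] over the cells gives the claim. *)
Lemma hit_indep t k A : (0 < t)%N -> hit_sigma [set s | (s < t)%N] A ->
  (P (A `&` hit (t, k)) = lam%:E * Q [set k] * P A)%E.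
Proof.
move=> t0 hA; have mA := hit_sigma_measurable hA.
pose F n : set T := [set w | exists2 c, choice.pickle c = n & cell t c w].
have F1 n : F n = set0 \/ exists c, F n = cell t c.
  have [[c cn]|nc] := pselect (exists c : seq (nat * int), choice.pickle c = n).
    right; exists c; apply/seteqP; split => w /=; last by exists c.
    by move=> [c' c'n]; rewrite (pcan_inj (@choice.pickleK _) (etrans c'n (esym cn))).
  by left; apply/seteqP; split => // w [c cn _]; apply: nc; exists c.
have mF n : measurable (F n).
  by have [->//|[c ->]] := F1 n; exact: measurable_cell.
have tF : trivIset setT F.
  by move=> m n _ _ [w [[c <- cw] [c' <- cw']]]; rewrite (cell_inj cw cw').
have UF : \bigcup_n F n = setT.
  apply/seteqP; split => // w _; have [c cw] := cell_cover w t0.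
  by exists (choice.pickle c) => //; exists c.
have split_ (B : set T) : measurable B -> (P B = \sum_(n <oo) P (B `&` F n))%E.
  move=> mB; rewrite -{1}(setIT B) -UF setI_bigcupr measure_semi_bigcup//.
  - by move=> n; exact: measurableI.
  - exact: trivIset_setIl.
  - by apply: bigcupT_measurable => n; exact: measurableI.
have mAh : measurable (A `&` hit (t, k)) by apply: measurableI => //; exact: measurable_hit.
have fQ : (lam%:E * Q [set k] = (lam * fine (Q [set k]))%:E)%E.
  by rewrite EFinM fineK// fin_num_measure.
rewrite (split_ _ mAh) (split_ _ mA) fQ -nneseriesZl//.
apply: eq_eseriesr => n _; rewrite -fQ.
have [->|[c ->]] := F1 n; first by rewrite !setI0 measure0 mule0.
have [[w [Aw cw]]|nA] := pselect (exists w, A w /\ cell t c w).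
  have cA : cell t c `<=` A by move=> w' cw'; exact: (hit_sigma_cell hA cw cw').
  by rewrite -setIA (setIC (hit _)) setIA (setIidr cA) cell_law.
have Ac : A `&` cell t c = set0.
  by apply/seteqP; split => // w Aw; apply: nA; exists w.
by rewrite -setIA (setIC (hit _)) setIA Ac set0I measure0 mule0.
Qed.


End MarkedBinomialLaw.

(** * Orthogonal decomposition *)

Lemma sigma_algebra_setT (T : Type) (G : set_system T) : sigma_algebra setT G -> G setT.
Proof. by case=> G0 GD _; rewrite -(setD0 setT); exact: GD. Qed.

Section SimpleFunctions.
Context {d : measure_display} {T : measurableType d} {R : realType}.
Variable P : probability T R.
Variables (G : set_system T) (Gm : G `<=` measurable) (sG : sigma_algebra setT G).

(** Linear combinations of indicators of [G], given inductively so that an identity of means reduces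
    to events. Being bounded, they multiply $L^2$ into itself. *)
Inductive simple : (T -> R) -> Prop :=
| simple_indic A : G A -> simple (\1_A)
| simple_add X Y : simple X -> simple Y -> simple (fun w => X w + Y w)
| simple_scale c X : simple X -> simple (fun w => c * X w).

Lemma eq_simple X Y : X =1 Y -> simple X -> simple Y.
Proof. by move=> /funext ->. Qed.

Lemma simple_cst c : simple (fun=> c).
Proof.
have := simple_scale c (simple_indic (sigma_algebra_setT sG)).
by apply: eq_simple => w; rewrite indicT mulr1.
Qed.

Lemma simple_mul X Y : simple X -> simple Y -> simple (fun w => X w * Y w).
Proof.
have GI A B : G A -> G B -> G (A `&` B).
  rewrite -(measurable_g_measurableTypeE sG); exact: measurableI.
move=> hX hY; elim: hX => [A GA|X1 X2 _ h1 _ h2|c X1 _ h1]; last 2 first.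
- by apply: eq_simple (simple_add h1 h2) => w; rewrite mulrDl.
- by apply: eq_simple (simple_scale c h1) => w; rewrite mulrA.
elim: hY => [B GB|Y1 Y2 _ h1 _ h2|c Y1 _ h1].
- by apply: eq_simple (simple_indic (GI _ _ GA GB)) => w; rewrite indicI.
- by apply: eq_simple (simple_add h1 h2) => w; rewrite mulrDr.
- by apply: eq_simple (simple_scale c h1) => w; rewrite mulrCA.
Qed.

Lemma simple_adapted X : simple X -> adapted G X.
Proof.
elim=> [A GA|X1 X2 _ h1 _ h2|c X1 _ h1]; [|exact: adaptedD|exact: adaptedZ].
by apply/(adaptedP sG); apply: measurable_indic; rewrite (measurable_g_measurableTypeE sG).
Qed.

Lemma simple_bounded X : simple X -> exists M, forall w, `|X w| <= M.
Proof.
elim=> [A GA|X1 X2 _ [M1 h1] _ [M2 h2]|c X1 _ [M1 h1]].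
- by exists 1 => w; rewrite indicE; case: (_ \in _); rewrite ?normr1 ?normr0.
- by exists (M1 + M2) => w; apply: le_trans (ler_normD _ _) _; exact: lerD.
- by exists (`|c| * M1) => w; rewrite normrM ler_wpM2l.
Qed.

Lemma simple_measurable X : simple X -> measurable_fun setT X.
Proof. by move/simple_adapted; exact: adapted_measurable. Qed.

Lemma simple_L2 X : simple X -> L2 P X.
Proof.
move=> sX; have [M hM] := simple_bounded sX.
by apply: L2_bounded hM; exact: simple_measurable.
Qed.

Lemma L2_mul_simple X Y : L2 P X -> simple Y -> L2 P (fun w => X w * Y w).
Proof.
move=> hX sY; have [M hM] := simple_bounded sY.
by apply: L2_bounded_mul hM hX; exact: simple_measurable.
Qed.

End SimpleFunctions.

(** * The increments at one time and their orthogonalization *)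

Section ChaosOrthogonality.
Context {d : measure_display} {T : measurableType d} {R : realType}.
Variable P : probability T R.
Variables (lam : R) (E : set int) (Q : probability int R).
Variables (I : set nat) (e : nat -> int).
Variables (xi : nat -> {RV P >-> nat}) (V : nat -> {RV P >-> int}).
Hypothesis lam01 : 0 < lam < 1.
Hypothesis Q_gt0 : forall k, E k -> (0 < Q [set k])%E.
Hypothesis E_enum : enumeration I E e.
Hypothesis process : is_marked_binomial xi V lam E Q.

Local Notation eta := (marked_process xi V).
Local Notation hit := (hit xi V).
Local Notation G := (hit_sigma E xi V).
Local Notation XX := (XX E).
Local Notation before t := [set s | (s < t)%N].
Local Notation dRi := (dR_idx P lam Q e eta).
Local Notation gam := (gamma P lam Q e eta).
Local Notation DR := (dR P lam Q I e eta).
Local Notation kap := (kappa P lam Q I e eta).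
Local Notation inner := (inner P).
Local Notation L2 := (L2 P).

Definition weight (k : int) : R := lam * fine (Q [set k]).

Let sG U := hit_sigma_algebra E xi V U.
Let Gm U := @hit_sigma_measurable _ _ _ _ E xi V U.

Lemma dZE x w : dZ lam Q eta x w = \1_(hit x) w - weight x.2.
Proof. by rewrite /dZ (eta_gt0 process). Qed.

(* The coefficients of the combination do not depend on the time. *)
Inductive stationary : (nat -> T -> R) -> Prop :=
| stationary_cst c : stationary (fun _ _ => c)
| stationary_hit k : E k -> stationary (fun t => \1_(hit (t, k)))
| stationary_add g h : stationary g -> stationary h -> stationary (fun t w => g t w + h t w)
| stationary_scale c g : stationary g -> stationary (fun t w => c * g t w).

Lemma eq_stationary g h : g =2 h -> stationary g -> stationary h.
Proof. by move=> gh; rewrite (_ : g = h)//; apply/funext => t; exact/funext/gh. Qed.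

(** Two marks never occur at the same time and indicators are idempotent, so products of generators
    are generators or 0. Second moments of the increments thus become means of stationary
    functions. *)
Lemma stationary_mul g h : stationary g -> stationary h ->
  stationary (fun t w => g t w * h t w).
Proof.
move=> hg hh; elim: hg => [c|k Ek|g1 g2 _ h1 _ h2|c g1 _ h1].
- exact: stationary_scale.
- elim: hh => [c|l El|g1 g2 _ h1 _ h2|c g1 _ h1].
  + by apply: eq_stationary (stationary_scale c (stationary_hit Ek)) => t w; rewrite mulrC.
  + have [<-|kl] := eqVneq k l.
      apply: eq_stationary (stationary_hit Ek) => t w.
      by rewrite -[RHS]/((\1_(hit (t, k)) \* \1_(hit (t, k))) w) -indicI setIid.
    apply: eq_stationary (stationary_cst 0) => t w.
    rewrite -[RHS]/((\1_(hit (t, k)) \* \1_(hit (t, l))) w) -indicI (hit_disjoint process).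
      by rewrite indic0.
    exact/eqP.
  + by apply: eq_stationary (stationary_add h1 h2) => t w; rewrite mulrDr.
  + by apply: eq_stationary (stationary_scale c h1) => t w; rewrite mulrCA.
- by apply: eq_stationary (stationary_add h1 h2) => t w; rewrite mulrDl.
- by apply: eq_stationary (stationary_scale c h1) => t w; rewrite mulrA.
Qed.

Lemma stationary_sum (J : Type) (r : seq J) (p : pred J) (g : J -> nat -> T -> R) :
  (forall j, p j -> stationary (g j)) -> stationary (fun t w => \sum_(j <- r | p j) g j t w).
Proof.
move=> hg; elim: r => [|j r IH].
  by apply: eq_stationary (stationary_cst 0) => t w; rewrite big_nil.
have [pj|pj] := boolP (p j).
  by apply: eq_stationary (stationary_add (hg j pj) IH) => t w; rewrite big_cons pj.
by apply: eq_stationary IH => t w; rewrite big_cons (negbTE pj).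
Qed.

Lemma stationary_simple (U : set nat) g t : stationary g -> (0 < t)%N -> U t ->
  simple (G U) (g t).
Proof.
move=> hg t0 Ut; elim: hg => [c|k Ek|g1 g2 _ h1 _ h2|c g1 _ h1].
- exact: simple_cst.
- by apply: simple_indic; apply: hit_sigma_hit.
- exact: simple_add.
- exact: simple_scale.
Qed.

Lemma stationary_L2 g t : stationary g -> (0 < t)%N -> L2 (g t).
Proof.
by move=> hg t0; apply: (simple_L2 P (@Gm setT) (@sG _)); exact: stationary_simple.
Qed.

Lemma mean_indic_hit t A k : (0 < t)%N -> G (before t) A ->
  mean P (fun w => \1_A w * \1_(hit (t, k)) w) = weight k * mean P (\1_A).
Proof.
move=> t0 GA; have mA := Gm GA; have mh := measurable_hit xi V (t, k).
rewrite -[X in mean P X]/(\1_A \* \1_(hit (t, k))) -indicI !mean_indic//; last exact: measurableI.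
rewrite (hit_indep process)// !fineM ?fin_num_measure// ?fin_numM// fin_num_measure//.
Qed.

(** By linearity in both factors this is [hit_indep]; the second mean may be taken at time 1 because
    [weight k] does not involve the time. *)
Lemma mean_simple_stationary t g X : (0 < t)%N -> stationary g -> simple (G (before t)) X ->
  mean P (fun w => X w * g t w) = mean P X * mean P (g 1%N).
Proof.
move=> t0 hg; elim => [A GA|X1 X2 hX1 h1 hX2 h2|c X1 hX1 h1]; last 2 first.
- have L1 : L2 X1 := simple_L2 P (@Gm _) (@sG _) hX1.
  have L2' : L2 X2 := simple_L2 P (@Gm _) (@sG _) hX2.
  have Lg : L2 (g t) := stationary_L2 hg t0.
  by rewrite -/(inner _ _) innerDl// /inner h1 h2 meanD ?mulrDl//; exact: L2_Lfun1.
- have L1 : L2 X1 := simple_L2 P (@Gm _) (@sG _) hX1.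
  have Lg : L2 (g t) := stationary_L2 hg t0.
  by rewrite -/(inner _ _) innerZl// /inner h1 meanZ ?mulrA//; exact: L2_Lfun1.
have LA : L2 (\1_A) by apply: L2_indic; exact: Gm GA.
elim: hg => [c|k Ek|g1 g2 hg1 h1 hg2 h2|c g1 hg1 h1].
- rewrite -/(inner _ _) innerC -[LHS]/(mean P (fun w => c * \1_A w)).
  by rewrite meanZ ?mean_cst 1?mulrC//; exact: L2_Lfun1.
- rewrite mean_indic_hit// mulrC; congr (_ * _).
  have := @mean_indic_hit 1 setT k isT; rewrite indicT mean_cst mulr1 => <-.
    by congr mean; apply/funext => w; rewrite mul1r.
  exact: sigma_algebra_setT (@sG _).
- rewrite -/(inner _ _) innerDr ?stationary_L2// /inner h1 h2.
  by rewrite meanD ?mulrDr//; apply: L2_Lfun1; exact: stationary_L2.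
- rewrite -/(inner _ _) innerZr ?stationary_L2// /inner h1 meanZ 1?mulrCA//.
  by apply: L2_Lfun1; exact: stationary_L2.
Qed.

Let I_down m n : (m <= n)%N -> I n -> I m.
Proof. by move=> mn In; exact: E_enum.1 mn In. Qed.

Let e_in n : I n -> E (e n).
Proof. by move=> In; have [_ [+ _ _]] := E_enum; apply. Qed.

Let e_inj m n : I m -> I n -> e m = e n -> m = n.
Proof.
move=> Im In; have [_ [_ + _]] := E_enum => /(_ m n).
by rewrite !mem_set// => /(_ isT isT).
Qed.

Lemma rankP k : E k -> I (rank I e k) /\ e (rank I e k) = k.
Proof.
move=> Ek; have [_ [_ _ /(_ k Ek)[n In nk]]] := E_enum.
by apply: (@xgetPex _ 0%N [set n | I n /\ e n = k]); exists n.
Qed.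

Lemma rank_e n : I n -> rank I e (e n) = n.
Proof. by move=> In; have [Ir er] := rankP (e_in In); exact: e_inj. Qed.

Lemma stationary_dR_idx n : I n -> stationary (dRi n).
Proof.
elim/ltn_ind: n => n IH In.
have h1 : stationary (fun t w => \1_(hit (t, e n)) w + - weight (e n)).
  by apply: stationary_add; [exact/stationary_hit/e_in|exact: stationary_cst].
have h2 : stationary (fun t w => \sum_(j < n) gam n j * dRi j t w).
  apply: stationary_sum => j _; apply: stationary_scale; apply: IH => //.
  exact: I_down (ltnW (ltn_ord j)) In.
apply: eq_stationary (stationary_add h1 (stationary_scale (-1) h2)) => t w.
by rewrite dR_idxE dZE mulN1r.
Qed.

Lemma mean_dZ k : E k -> mean P (dZ lam Q eta (1%N, k)) = 0.
Proof.
move=> Ek; have -> : dZ lam Q eta (1%N, k) = fun w => \1_(hit (1%N, k)) w + - weight k.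
  by apply/funext => w; rewrite dZE.
have Lh : L2 (\1_(hit (1%N, k))) by apply: L2_indic; exact: measurable_hit.
rewrite meanD ?mean_cst; [|exact: L2_Lfun1|exact/L2_Lfun1/L2_cst].
have := @mean_indic_hit 1 setT k isT (sigma_algebra_setT (@sG _)).
rewrite indicT mean_cst mulr1 => <-.
by apply/eqP; rewrite subr_eq0; apply/eqP; congr mean; apply/funext => w; rewrite mul1r.
Qed.

Lemma L2_dR_idx n t : I n -> (0 < t)%N -> L2 (dRi n t).
Proof. by move=> In t0; apply: stationary_L2 => //; exact: stationary_dR_idx. Qed.

Lemma L2_dZ k : L2 (dZ lam Q eta (1%N, k)).
Proof.
apply: eq_L2 (L2B (L2_indic P (measurable_hit xi V (1%N, k))) (L2_cst P (weight k))) => w.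
by rewrite dZE.
Qed.

Lemma dR_idxE1 n : dRi n 1%N =
  fun w => dZ lam Q eta (1%N, e n) w - \sum_(j < n) gam n j * dRi j 1%N w.
Proof. by apply/funext => w; rewrite dR_idxE. Qed.

Lemma inner_dR_idx n W : I n -> L2 W -> inner (dRi n 1%N) W =
  inner (dZ lam Q eta (1%N, e n)) W - \sum_(j < n) gam n j * inner (dRi j 1%N) W.
Proof.
move=> In hW; have Lj (j : 'I_n) : L2 (dRi j 1%N).
  by apply: L2_dR_idx => //; exact: I_down (ltnW (ltn_ord j)) In.
rewrite {1}dR_idxE1 innerBl//; [|exact: L2_dZ|by apply: L2_sum => j _; exact: L2Z].
rewrite inner_suml//; last by move=> j _; exact: L2Z.
by congr (_ - _); apply: eq_bigr => j _; rewrite innerZl.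
Qed.

Lemma mean_dR_idx n : I n -> mean P (dRi n 1%N) = 0.
Proof.
elim/ltn_ind: n => n IH In.
rewrite -inner_cst1 inner_dR_idx//; last exact: L2_cst.
rewrite inner_cst1 mean_dZ; last exact: e_in.
rewrite big1 ?subr0// => j _.
by rewrite inner_cst1 IH ?mulr0//; exact: I_down (ltnW (ltn_ord j)) In.
Qed.

(* On the event that no mark [e 0, ..., e n] occurs at time 1, the variable
   [dRi n 1] is a constant, and its value increases by 1 if [e n] occurs. *)
Lemma dR_idx_jump n w w' : I n -> hit (1%N, e n) w ->
  (forall j, (j <= n)%N -> ~ hit (1%N, e j) w') -> dRi n 1%N w = dRi n 1%N w' + 1.
Proof.
move=> In hw hw'.
have nh j : (j < n)%N -> ~ hit (1%N, e j) w.
  move=> jn hj; have := hit_disjoint process 1 (k := e j) (l := e n).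
  have ne : e j <> e n.
    move=> /(e_inj (I_down (ltnW jn) In) In) jE; by rewrite jE ltnn in jn.
  by move=> /(_ ne)/seteqP[/(_ w) + _]; apply.
have same j : (j < n)%N -> dRi j 1%N w = dRi j 1%N w'.
  elim/ltn_ind: j => j IH jn; rewrite !dR_idxE !dZE !indicE !memNset/=.
  - congr (_ - _); apply: eq_bigr => i _; rewrite IH//; exact: ltn_trans jn.
  - exact: hw' (ltnW jn).
  - exact: nh.
rewrite !dR_idxE !dZE !indicE mem_set// memNset/=; last exact: hw'.
rewrite (eq_bigr (fun j : 'I_n => gam n j * dRi j 1%N w')); first by ring.
by move=> j _; rewrite same.
Qed.

(** Nondegeneracy, on which every division by [kappa] rests. If the variable were almost surely 0,
    it would vanish somewhere on each event of positive probability, in particular on [hit (1, e n)]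
    and on the event that no point has time 1. By [dR_idx_jump] its values there differ by 1. *)
Lemma sqnorm_dR_idx_gt0 n : I n -> 0 < sqnorm P (dRi n 1%N).
Proof.
move=> In; rewrite lt_def sqnorm_ge0 andbT; apply/eqP => n0.
have [N [mN PN sN]] := sqnorm0_ae (@L2_dR_idx n 1%N In isT) n0.
have ex A : measurable A -> (0 < P A)%E -> exists2 w, A w & dRi n 1%N w = 0.
  move=> mA PA; apply: contrapT => nex.
  suff /(@le_measure _ _ _ P) : A `<=` N.
    rewrite !inE => /(_ mA mN) AN; have := lt_le_trans PA AN.
    by rewrite [X in (_ < X)%E](PN : P N = 0%E) ltxx.
  by move=> w Aw; apply: sN => /= /(_ Logic.I) dw; apply: nex; exists w.
have [|w hw w0] := ex _ (measurable_hit xi V (1%N, e n)).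
  rewrite -(setTI (hit _)) (hit_indep process)//; last exact: sigma_algebra_setT (@sG _).
  rewrite probability_setT mule1 mule_gt0// ?lte_fin; first by case/andP: lam01.
  by apply: Q_gt0; exact: e_in.
(* A first gap above 1 means that there is no point at time 1; its probability is [1 - lam > 0]. *)
have [||w' hw' w'0] := ex (xi 0%N @^-1` [set m | (1 < m)%N]).
- by rewrite -[X in measurable X]setTI; apply: (measurable_funPT (xi 0%N)).
- rewrite (xi_tail process) expr1 lte_fin; by have := lam01; lra.
have nh j : (j <= n)%N -> ~ hit (1%N, e j) w'.
  move=> _ [i /= ai _].
  have : (arrival xi 0 w' <= arrival xi i w')%N.
    by case: i {ai} => // i; apply/ltnW/(arrival_lt process).
  by rewrite ai arrival0 leqNgt hw'.
by move: w0; rewrite (dR_idx_jump In hw nh) w'0 add0r => /eqP; rewrite oner_eq0.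
Qed.

Lemma dR_idx_orth m n : I m -> I n -> m != n -> inner (dRi m 1%N) (dRi n 1%N) = 0.
Proof.
wlog mn : m n / (m < n)%N.
  move=> H Im In mn; move: (mn); rewrite neq_ltn => /orP[|] h; first exact: H.
  by rewrite innerC; apply: H => //; rewrite eq_sym.
move=> Im In _; elim/ltn_ind: n m mn Im In => n IH m mn Im In.
have Lm := @L2_dR_idx m 1%N Im isT.
rewrite innerC inner_dR_idx// (bigD1 (Ordinal mn))//= big1 => [|j jm]; last first.
  have Ij : I j by exact: I_down (ltnW (ltn_ord j)) In.
  suff -> : inner (dRi j 1%N) (dRi m 1%N) = 0 by rewrite mulr0.
  have : (j : nat) != m by [].
  rewrite neq_ltn => /orP[jm'|mj]; first exact: IH.
  by rewrite innerC; apply: IH.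
rewrite addr0 /gamma.
have -> : mean P (fun v => dRi m 1%N v ^+ 2) = inner (dRi m 1%N) (dRi m 1%N).
  by congr mean; apply/funext => w; rewrite expr2.
by rewrite divfK ?subrr// gt_eqF// sqnorm_dR_idx_gt0.
Qed.

Lemma XX_rank x : XX x -> I (rank I e x.2) /\ e (rank I e x.2) = x.2.
Proof. by move=> [_ Ex]; exact: rankP. Qed.

Lemma kappa_sqnorm k : kap k = sqnorm P (dRi (rank I e k) 1%N).
Proof. by congr mean; apply/funext => w; rewrite expr2. Qed.

Lemma kappa_gt0 k : E k -> 0 < kap k.
Proof. by move=> /rankP[Ir _]; rewrite kappa_sqnorm sqnorm_dR_idx_gt0. Qed.

Lemma simple_dR (U : set nat) x : XX x -> U x.1 -> simple (G U) (DR x).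
Proof.
by move=> Xx Ux; apply: stationary_simple Xx.1 Ux; apply: stationary_dR_idx; exact: (XX_rank Xx).1.
Qed.

Lemma mean_mul_dR x X : XX x -> simple (G (before x.1)) X ->
  mean P (fun w => X w * DR x w) = 0.
Proof.
move=> Xx sX; have [Ir _] := XX_rank Xx.
by rewrite (mean_simple_stationary Xx.1 (stationary_dR_idx Ir) sX) mean_dR_idx ?mulr0.
Qed.

(** [DR x * DR y] is stationary by [stationary_mul], so the past [X] factors out and the
    orthogonality at time 1 decides. *)
Lemma mean_mul_dR_dR x y X : XX x -> XX y -> x.1 = y.1 -> simple (G (before x.1)) X ->
  mean P (fun w => X w * (DR x w * DR y w)) = (x == y)%:R * kap x.2 * mean P X.
Proof.
move=> Xx Xy xy sX; have [Ix ex] := XX_rank Xx; have [Iy ey] := XX_rank Xy.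
have h := mean_simple_stationary Xx.1
  (stationary_mul (stationary_dR_idx Ix) (stationary_dR_idx Iy)) sX.
have -> : (fun w => X w * (DR x w * DR y w)) =
    (fun w => X w * (dRi (rank I e x.2) x.1 w * dRi (rank I e y.2) x.1 w)).
  by apply/funext => w; rewrite /dR -xy.
rewrite h mulrC; congr (_ * _).
have [<-|xNy] := eqVneq x y; first by rewrite mul1r kappa_sqnorm.
rewrite mul0r; apply: dR_idx_orth => //; apply: contra_neq xNy => rxy.
by rewrite (surjective_pairing x) (surjective_pairing y) xy -ex -ey rxy.
Qed.

(** * Products of increments over chains of points *)

Definition chaos (z : seq point_tm) (w : T) : R := \prod_(x <- z) DR x w.

(** The squared norm of [chaos z] when [z] is a chain. *)
Definition kappas (z : seq point_tm) : R := \prod_(x <- z) kap x.2.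

(** The analogue of [Xlt] for sequences, so that chains of all lengths live in one type; [U]
    restricts the times. *)
Definition chain (U : set nat) (z : seq point_tm) : Prop :=
  (forall x, x \in z -> XX x /\ U x.1) /\ sorted ltn [seq x.1 | x <- z].

Lemma chain_sub U U' z : U `<=` U' -> chain U z -> chain U' z.
Proof. by move=> UU [zU sz]; split => // x /zU[Xx Ux]; split => //; exact: UU. Qed.

(** Splits off the latest point, whose increment is independent of all the others. The inductions on
    chains therefore run from the end. *)
Lemma chain_rcons U z x : chain U (rcons z x) <->
  [/\ chain (fun s => U s /\ (s < x.1)%N) z, XX x & U x.1].
Proof.
have srt : sorted ltn [seq y.1 | y <- rcons z x] =
    sorted ltn [seq y.1 | y <- z] && all (fun y => (y.1 < x.1)%N) z.
  have tr : transitive (fun m n => (n < m)%N) by move=> ? ? ? /[swap]; exact: ltn_trans.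
  rewrite map_rcons -(rev_sorted (fun m n => (n < m)%N)) rev_rcons /=.
  by rewrite (path_sortedE tr) rev_sorted all_rev all_map andbC.
split=> [[zU]|[[zU sz] Xx Ux]].
  rewrite srt => /andP[sz /allP az]; split; last 2 first.
  - by have [] := zU x; rewrite ?mem_rcons ?mem_head.
  - by have [] := zU x; rewrite ?mem_rcons ?mem_head.
  split => // y yz; have [|Xy Uy] := zU y; first by rewrite mem_rcons inE yz orbT.
  by split => //; split => //; exact: az.
split; first by move=> y; rewrite mem_rcons inE => /predU1P[->//|/zU[? []]].
by rewrite srt sz; apply/allP => y /zU[_ []].
Qed.

Lemma chain_nil U : chain U [::].
Proof. by []. Qed.

Lemma chaos_rcons z x w : chaos (rcons z x) w = chaos z w * DR x w.
Proof. by rewrite /chaos -cats1 big_cat big_seq1. Qed.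

Lemma kappas_rcons z x : kappas (rcons z x) = kappas z * kap x.2.
Proof. by rewrite /kappas -cats1 big_cat big_seq1. Qed.

Lemma chaos_nil : chaos [::] = fun=> 1.
Proof. by apply/funext => w; rewrite /chaos big_nil. Qed.

Lemma simple_chaos (U : set nat) z : (forall x, x \in z -> XX x /\ U x.1) -> simple (G U) (chaos z).
Proof.
elim: z => [|x z IH] zU; first by rewrite chaos_nil; exact: simple_cst.
have [|Xx Ux] := zU x; first exact: mem_head.
apply: (eq_simple (X := fun w => DR x w * chaos z w)); first by move=> w; rewrite /chaos big_cons.
apply: (simple_mul (@sG _)); first exact: simple_dR.
by apply: IH => y yz; apply: zU; rewrite inE yz orbT.
Qed.

Lemma L2_simple U X : simple (G U) X -> L2 X.
Proof. exact: simple_L2. Qed.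

Lemma L2_chaos U z : chain U z -> L2 (chaos z).
Proof. by move=> [zU _]; apply: (@L2_simple U); exact: simple_chaos. Qed.

Lemma L2_mul_dR X x : L2 X -> XX x -> L2 (fun w => X w * DR x w).
Proof.
by move=> hX Xx; apply: (L2_mul_simple (@Gm setT) (@sG _)) => //; exact: simple_dR.
Qed.

Lemma kappas_gt0 U z : chain U z -> 0 < kappas z.
Proof.
move=> [zU _]; rewrite /kappas big_seq; apply: prodr_gt0 => x /zU[[_ Ex] _].
exact: kappa_gt0.
Qed.

(** The two last points are compared. If their times differ, the later one carries a centred
    increment independent of all other factors, and the mean is 0. If they agree, [mean_mul_dR_dR]
    extracts the factor of the last points and the induction goes on with the rest. *)
Lemma chaos_orth U z z' : chain U z -> chain U z' ->
  inner (chaos z) (chaos z') = (z == z')%:R * kappas z.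
Proof.
have last0 U' y x X : chain U' (rcons y x) -> simple (G (before x.1)) X ->
    inner (chaos (rcons y x)) X = 0.
  move=> /chain_rcons[[yU _] Xx _] sX.
  have sy : simple (G (before x.1)) (chaos y) by apply: simple_chaos => u /yU[? []].
  rewrite -[RHS](mean_mul_dR Xx (simple_mul (@sG _) sy sX)); congr mean.
  by apply/funext => w; rewrite chaos_rcons; ring.
have nil0 y x : (rcons y x == [::]) = false by case: y.
elim/last_ind: z z' => [|y x IH] z'.
  case/lastP: z' => [|y' x'] _ hz'.
    by rewrite /kappas big_nil chaos_nil inner_cst1 mean_cst mul1r.
  rewrite innerC (last0 _ _ _ _ hz'); last by rewrite chaos_nil; exact: simple_cst.
  by rewrite eq_sym nil0 mul0r.
case/lastP: z' => [|y' x'] hz hz'.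
  by rewrite (last0 _ _ _ _ hz) ?nil0 ?mul0r//; rewrite chaos_nil; exact: simple_cst.
have [cy Xx Ux] := (chain_rcons _ _ _).1 hz; have [cy' Xx' Ux'] := (chain_rcons _ _ _).1 hz'.
rewrite eqseq_rcons.
have [xx'|xx'|xx'] := ltngtP x.1 x'.1.
- rewrite innerC (last0 _ _ _ _ hz'); last first.
    apply: simple_chaos => u; rewrite mem_rcons inE => /predU1P[->//|/cy.1[Xu [_ ux]]].
    by split => //; exact: ltn_trans xx'.
  have [xE|] := eqVneq x x'; last by rewrite andbF mul0r.
  by rewrite xE ltnn in xx'.
- rewrite (last0 _ _ _ _ hz); last first.
    apply: simple_chaos => u; rewrite mem_rcons inE => /predU1P[->//|/cy'.1[Xu [_ ux]]].
    by split => //; exact: ltn_trans xx'.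
  have [xE|] := eqVneq x x'; last by rewrite andbF mul0r.
  by rewrite xE ltnn in xx'.
have sy : simple (G (before x.1)) (chaos y) by apply: simple_chaos => u /cy.1[? []].
have sy' : simple (G (before x.1)) (chaos y').
  by apply: simple_chaos => u /cy'.1[? []]; rewrite xx'.
have -> : inner (chaos (rcons y x)) (chaos (rcons y' x')) =
    mean P (fun w => (chaos y w * chaos y' w) * (DR x w * DR x' w)).
  by congr mean; apply/funext => w; rewrite !chaos_rcons; ring.
rewrite (mean_mul_dR_dR Xx Xx' xx' (simple_mul (@sG _) sy sy')) -/(inner _ _) kappas_rcons.
rewrite IH; last 2 first.
- by apply: chain_sub cy => s [].
- by apply: chain_sub cy' => s [].
by case: (x == x'); case: (y == y'); rewrite /= ?mulr1n ?mulr0n; ring.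
Qed.

Definition points_in (U : set nat) (z : seq point_tm) : Prop := forall x, x \in z -> XX x /\ U x.1.

Lemma chaos_perm z z' : perm_eq z z' -> chaos z = chaos z'.
Proof. by move=> zz'; apply/funext => w; exact: perm_big. Qed.

Lemma kappas_perm z z' : perm_eq z z' -> kappas z = kappas z'.
Proof. by move=> zz'; exact: perm_big. Qed.

Definition sort_time : seq point_tm -> seq point_tm := sort (fun x y => x.1 <= y.1)%N.

Lemma perm_sort_time z : perm_eq (sort_time z) z.
Proof. by rewrite perm_sort. Qed.

Lemma chain_sort_time U z : points_in U z -> uniq [seq x.1 | x <- z] -> chain U (sort_time z).
Proof.
move=> zU uz; split; first by move=> x; rewrite mem_sort; exact: zU.
rewrite ltn_sorted_uniq_leq (perm_uniq (perm_map fst (perm_sort_time z))) uz /=.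
rewrite sorted_map; apply: sort_sorted => x y; exact: leq_total.
Qed.

(** * Totality of the chaoses *)

Section Totality.
Variables (U : set nat) (H : T -> R).
Hypothesis H2 : L2 H.
Hypothesis H_orth : forall z, chain U z -> inner H (chaos z) = 0.

Lemma orth_chaos z : points_in U z -> uniq [seq x.1 | x <- z] -> inner H (chaos z) = 0.
Proof.
move=> zU uz; rewrite -(chaos_perm (perm_sort_time z)); apply: H_orth.
exact: chain_sort_time.
Qed.

Lemma simple_indic_hit x : XX x -> U x.1 -> simple (G U) (\1_(hit x) : T -> R).
Proof. by move=> Xx Ux; apply: simple_indic; exact: hit_sigma_hit. Qed.

Lemma simple_prod_hit z : points_in U z -> simple (G U) (fun w => \prod_(x <- z) \1_(hit x) w : R).
Proof.
elim: z => [|x z IH] zU.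
  by apply: eq_simple (simple_cst (@sG _) 1) => w; rewrite big_nil.
have [Xx Ux] := zU x (mem_head _ _).
have zU' : points_in U z by move=> y yz; apply: zU; rewrite inE yz orbT.
by apply: eq_simple (simple_mul (@sG _) (simple_indic_hit Xx Ux) (IH zU')) => w; rewrite big_cons.
Qed.

(** Inverts the triangular Gram-Schmidt relation. The sum runs over the marks of smaller rank, hence
    is finite even for infinite [E]. *)
Lemma indic_hit_dR x w : XX x -> \1_(hit x) w = weight x.2 + DR x w +
  \sum_(j < rank I e x.2) gam (rank I e x.2) j * DR (x.1, e j) w.
Proof.
move=> Xx; have [Ir er] := XX_rank Xx.
have -> : DR x w = dRi (rank I e x.2) x.1 w by [].
rewrite dR_idxE dZE er -surjective_pairing.
rewrite (eq_bigr (fun j : 'I_(rank I e x.2) => gam (rank I e x.2) j * DR (x.1, e j) w)).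
  by ring.
by move=> j _; rewrite /dR /= rank_e//; exact: I_down (ltnW (ltn_ord j)) Ir.
Qed.

(** Indicators are exchanged for increments one point at a time. [indic_hit_dR] replaces the head of
    [z] by a constant and by increments at the same time, so the times stay distinct and the
    induction hypothesis covers each term. *)
Lemma orth_chaos_hit y z : points_in U (y ++ z) -> uniq [seq x.1 | x <- y ++ z] ->
  inner H (fun w => chaos y w * \prod_(x <- z) \1_(hit x) w) = 0.
Proof.
elim: z y => [|x z IH] y yzU uyz.
  rewrite cats0 in yzU uyz; rewrite -[RHS](orth_chaos yzU uyz); congr inner.
  by apply/funext => w; rewrite big_nil mulr1.
have pU x' : x'.1 = x.1 -> XX x' -> points_in U (rcons y x' ++ z).
  move=> x'1 Xx' u; rewrite cat_rcons mem_cat inE => /or3P[uy|/eqP ->|uz].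
  - by apply: yzU; rewrite mem_cat uy.
  - by split => //; rewrite x'1; apply: (yzU x _).2; rewrite mem_cat mem_head orbT.
  - by apply: yzU; rewrite mem_cat inE uz !orbT.
have [Xx Ux] : XX x /\ U x.1 by apply: yzU; rewrite mem_cat mem_head orbT.
have hx x' : x'.1 = x.1 -> XX x' ->
    inner H (fun w => chaos (rcons y x') w * \prod_(x <- z) \1_(hit x) w) = 0.
  move=> x'1 Xx'; apply: IH; first exact: pU.
  by rewrite cat_rcons map_cat /= x'1 -[_ :: _]/[seq u.1 | u <- x :: z] -map_cat.
have yzU' : points_in U (y ++ z).
  by move=> u; rewrite mem_cat => uyz'; apply: yzU; rewrite mem_cat inE orbCA uyz' orbT.
have h0 : inner H (fun w => chaos y w * \prod_(x <- z) \1_(hit x) w) = 0.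
  apply: IH => //; apply: subseq_uniq uyz; apply: map_subseq.
  by apply: cat_subseq => //; exact: subseq_cons.
have LX y' : points_in U (y' ++ z) -> L2 (fun w => chaos y' w * \prod_(x <- z) \1_(hit x) w).
  move=> py; apply: (@L2_simple U); apply: (simple_mul (@sG _)).
    by apply: simple_chaos => u uy; apply: py; rewrite mem_cat uy.
  by apply: simple_prod_hit => u uz; apply: py; rewrite mem_cat uz orbT.
have [Ir er] := XX_rank Xx.
have Xj (j : 'I_(rank I e x.2)) : XX (x.1, e j).
  by split; [exact: Xx.1|apply: e_in; exact: I_down (ltnW (ltn_ord j)) Ir].
have -> : (fun w => chaos y w * \prod_(x <- x :: z) \1_(hit x) w) = (fun w =>
    (weight x.2 * (chaos y w * \prod_(x <- z) \1_(hit x) w) +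
      chaos (rcons y x) w * \prod_(x <- z) \1_(hit x) w) +
    \sum_(j < rank I e x.2) gam (rank I e x.2) j *
      (chaos (rcons y (x.1, e j)) w * \prod_(x <- z) \1_(hit x) w)).
  apply/funext => w; rewrite big_cons (indic_hit_dR w Xx) chaos_rcons.
  rewrite [in RHS](eq_bigr (fun j : 'I_(rank I e x.2) => (chaos y w * \prod_(x <- z) \1_(hit x) w) *
     (gam (rank I e x.2) j * DR (x.1, e j) w))); last by move=> j _; rewrite chaos_rcons; ring.
  by rewrite -mulr_sumr; ring.
have Lx := LX _ (pU x erefl Xx); have Ly := LX _ yzU'.
have Lj (j : 'I_(rank I e x.2)) := LX _ (pU (x.1, e j) erefl (Xj j)).
have Ls : L2 (fun w => \sum_(j < rank I e x.2) gam (rank I e x.2) j *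
      (chaos (rcons y (x.1, e j)) w * \prod_(x <- z) \1_(hit x) w)).
  by apply: L2_sum => j _; exact: L2Z.
rewrite innerDr//; last by apply: L2D => //; exact: L2Z.
rewrite innerDr//; last exact: L2Z.
rewrite innerZr// h0 hx// innerC inner_suml//; last by move=> j _; exact: L2Z.
rewrite big1 ?mulr0 ?addr0// => j _.
by rewrite innerZl// innerC hx ?mulr0.
Qed.

(** Reduces to distinct times: repeated points do not change a product of indicators, and two
    different points with the same time make it 0. *)
Lemma orth_prod_hit z : points_in U z -> inner H (fun w => \prod_(x <- z) \1_(hit x) w) = 0.
Proof.
move=> zU; have [uz|nuz] := boolP (uniq [seq x.1 | x <- undup z]).
  have zU' : points_in U ([::] ++ undup z) by move=> u /=; rewrite mem_undup; exact: zU.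
  rewrite -[RHS](orth_chaos_hit zU' uz); congr inner; apply/funext => w.
  rewrite chaos_nil mul1r.
  have bE (x : point_tm) : \1_(hit x) w = (w \in hit x)%:R :> R by rewrite indicE.
  have bigE s : \prod_(x <- s) \1_(hit x) w = (all (fun x => w \in hit x) s)%:R :> R.
    elim: s => [|u s IHs]; first by rewrite big_nil.
    by rewrite big_cons IHs bE /=; case: (w \in _); rewrite ?mul1r ?mul0r.
  by rewrite !bigE; congr (_%:R); congr nat_of_bool; apply: eq_all_r => u; rewrite mem_undup.
have [x [y [xz yz xNy xy1]]] : exists x y : point_tm, [/\ x \in z, y \in z, x != y & x.1 = y.1].
  apply: contrapT => nex; move/negP: nuz; apply; rewrite map_inj_in_uniq ?undup_uniq//.
  move=> x y; rewrite !mem_undup => xz yz xy1; apply/eqP; apply: contrapT => /negP xNy.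
  by apply: nex; exists x, y.
rewrite -[RHS](_ : inner H (fun w => 0 * H w) = 0); last by rewrite innerZr// mul0r.
congr inner; apply/funext => w; rewrite mul0r.
have hxy : ~ (hit x w /\ hit y w).
  move=> [hx hy]; have /seteqP[/(_ w) + _] : hit (x.1, x.2) `&` hit (x.1, y.2) = set0.
    apply: (hit_disjoint process) => xy2; move/eqP: xNy; apply.
    by rewrite (surjective_pairing x) (surjective_pairing y) xy1 xy2.
  by apply; split; rewrite -?surjective_pairing// xy1 -surjective_pairing.
have z0 u : u \in z -> ~ hit u w -> \prod_(x <- z) \1_(hit x) w = 0 :> R.
  move=> uz nu; apply/eqP; rewrite prodf_seq_eq0; apply/hasP; exists u => //=.
  by rewrite indicE memNset.
by have [hx|] := pselect (hit x w); [apply: (z0 y) => // hy; exact: hxy|exact: z0].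
Qed.

(** A Dynkin class argument: the finite intersections of events [hit x] are stable under
    intersection and generate the sigma-algebra. The whole space belongs to the class because of the
    empty chain, whose chaos is 1. *)
Lemma orth_hit_sigma A : G U A -> inner H (\1_A) = 0.
Proof.
pose B (z : seq point_tm) : set T := [set w | forall x, x \in z -> hit x w].
have B0 : B [::] = setT by apply/seteqP; split.
have BS x z : B (x :: z) = hit x `&` B z.
  apply/seteqP; split => u /=.
    by move=> h; split=> [|y yz]; apply: h; rewrite inE ?eqxx ?yz ?orbT.
  by move=> [hx h] y; rewrite inE => /predU1P[->//|/h].
have mB z : measurable (B z).
  by elim: z => [|x z IH]; rewrite ?B0// BS; apply: measurableI => //; exact: measurable_hit.
have BE z : \1_(B z) = (fun w => \prod_(x <- z) \1_(hit x) w) :> (T -> R).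
  apply/funext => w; elim: z => [|x z IH].
    by rewrite big_nil B0 indicT.
  by rewrite big_cons -IH BS indicI.
pose C := [set B z | z in points_in U].
have CI : setI_closed C.
  move=> _ _ [z zU <-] [z' zU' <-]; exists (z ++ z').
    by move=> x; rewrite mem_cat => /orP[/zU|/zU'].
  apply/seteqP; split => w /=.
    by move=> h; split=> x xz; apply: h; rewrite mem_cat xz ?orbT.
  by move=> [h h'] x; rewrite mem_cat => /orP[/h|/h'].
have Cm : C `<=` measurable by move=> _ [z _ <-].
have GC : G U `<=` <<s C >>.
  apply: smallest_sub; first exact: smallest_sigma_algebra.
  move=> _ [x [Xx Ux] <-]; apply: sub_sigma_algebra; exists [:: x].
    by move=> y; rewrite inE => /eqP ->.
  by apply/seteqP; split => w /= => [h|h y]; [apply: h; rewrite inE|rewrite inE => /eqP ->].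
move=> /GC; rewrite -(setI_closed_g_dynkin_g_sigma_algebra CI).
pose D : set_system T := [set A | measurable A /\ inner H (\1_A) = 0].
suff : <<d C >> `<=` D by move=> /[apply] -[].
apply: smallest_sub; last first.
  move=> B' CB; split; first exact: Cm.
  by case: CB => z zU <-; rewrite BE; exact: orth_prod_hit.
have H1 : P.-integrable setT (EFin \o H) by apply/Lfun1_integrable; exact: L2_Lfun1.
have DT : D setT.
  split => //; rewrite indicT -[cst 1]chaos_nil; apply: orth_chaos => //.
split => // [B' [mB' hB']|F tF DF].
  split; first exact: measurableC.
  have -> : \1_(~` B') = (fun w => \1_setT w - \1_B' w) :> (T -> R).
    by apply/funext => w; rewrite !indicE in_setT in_setC; case: (w \in B'); rewrite ?subrr ?subr0.
  rewrite innerBr// ?hB' ?DT.2 ?subrr//; exact: L2_indic.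
have mF n : measurable (F n) by have [] := DF n.
split; first exact: bigcupT_measurable.
rewrite /inner mean_integral; last exact: bigcupT_measurable.
rewrite integral_bigcup//; last by apply: integrableS H1 => //; exact: bigcupT_measurable.
rewrite eseries0// => n _ _.
have iF : P.-integrable (F n) (EFin \o H) by apply: integrableS H1.
rewrite -(fineK (integrable_fin_num (mF n) iF)) -mean_integral//.
by have [_] := DF n; rewrite /inner => ->.
Qed.

End Totality.

Lemma orth_adapted_sqnorm0 U H : adapted (G U) H -> L2 H ->
  (forall z, chain U z -> inner H (chaos z) = 0) -> sqnorm P H = 0.
Proof.
move=> aH H2 H_orth.
have H0 : ae_eq P setT H (cst 0).
  apply: (adapted_ae0 (@Gm U) (@sG U) aH (L2_Lfun1 H2)) => A GA.
  exact: orth_hit_sigma H2 H_orth _ GA.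
by have [] := ae0_L2 (L2_measurable H2) H0.
Qed.

(** * Series of chaoses, indexed by tuples of one length or by chains of all lengths *)

Section ChaosSeries.
Context {J0 : choiceType}.
Variables (U : set nat) (A : set J0) (v : J0 -> seq point_tm) (c : J0 -> R).
Hypothesis v_chain : forall i, A i -> chain U (v i).
Hypothesis v_inj : forall i j, A i -> A j -> v i = v j -> i = j.

Local Notation psi := (fun i w => c i * chaos (v i) w).

Lemma in_L2_chaos_term i : A i -> in_L2 P (G U) (psi i).
Proof.
move=> Ai; apply: in_L2E; last by apply: L2Z; exact: L2_chaos (v_chain Ai).
apply: (adaptedZ (@sG U)); apply: (simple_adapted (@sG U)).
by apply: simple_chaos; exact: (v_chain Ai).1.
Qed.

Lemma inner_chaos_term U' i z : A i -> chain U' z ->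
  inner (psi i) (chaos z) = if v i == z then c i * kappas (v i) else 0.
Proof.
move=> Ai hz; have hi := v_chain Ai.
rewrite innerZl; [|exact: L2_chaos hi|exact: L2_chaos hz].
rewrite (@chaos_orth setT); [|exact: chain_sub hi|exact: chain_sub hz].
by case: eqP => _; rewrite ?mul1r// mul0r mulr0.
Qed.

Lemma chaos_term_orth i j : A i -> A j -> i != j -> inner (psi i) (psi j) = 0.
Proof.
move=> Ai Aj ij; have hj := v_chain Aj.
rewrite innerZr; [|exact: L2_chaos hj|by apply: L2Z; exact: L2_chaos (v_chain Ai)].
rewrite (inner_chaos_term Ai hj); case: eqP => [vij|]; last by rewrite mulr0.
by move/eqP: ij; case; exact: v_inj.
Qed.

Lemma sqnorm_chaos_term i : A i -> sqnorm P (psi i) = c i ^+ 2 * kappas (v i).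
Proof.
move=> Ai; have hi := v_chain Ai; rewrite sqnormZ; last exact: L2_chaos hi.
by rewrite /sqnorm (chaos_orth hi hi) eqxx mul1r.
Qed.

Lemma chaos_series_cvg M :
  (forall J : {fset J0}, \sum_(i <- J | i \in A) c i ^+ 2 * kappas (v i) <= M) ->
  exists S, L2_cvg P (G U) summability.totally (partial_sum A psi) S.
Proof.
move=> bM; apply: (orthogonal_series_cvg (@Gm U) (@sG U) in_L2_chaos_term chaos_term_orth (M := M)).
move=> J; apply: le_trans (bM J).
by under eq_bigr => i /set_mem Ai do rewrite (sqnorm_chaos_term Ai).
Qed.

(** Null coefficients are allowed whatever the inner product is. This serves the gradient: a slice
    vanishes at [y] when the time of [x] occurs in [y], where [F_dR] need not be orthogonal to
    [chaos y]. *)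
Lemma chaos_bessel W : L2 W ->
  (forall i, A i -> c i = 0 \/ inner W (chaos (v i)) = c i * kappas (v i)) ->
  forall J : {fset J0}, \sum_(i <- J | i \in A) c i ^+ 2 * kappas (v i) <= sqnorm P W.
Proof.
move=> hW Wc J; have := bessel (@Gm U) in_L2_chaos_term chaos_term_orth hW.
have h i : A i -> inner W (psi i) = sqnorm P (psi i).
  move=> Ai; have hi := v_chain Ai.
  rewrite (sqnorm_chaos_term Ai) innerZr//; last exact: L2_chaos hi.
  by have [->|->] := Wc i Ai; rewrite ?expr0n ?mul0r//; ring.
move=> /(_ h J); apply: le_trans.
by under [leRHS]eq_bigr => i /set_mem Ai do rewrite (sqnorm_chaos_term Ai).
Qed.

Section Limit.
Variable S : T -> R.
Hypothesis cvgS : L2_cvg P (G U) summability.totally (partial_sum A psi) S.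

Lemma inner_chaos_series U' z i : chain U' z -> A i -> v i = z ->
  inner S (chaos z) = c i * kappas z.
Proof.
move=> hz Ai vi; rewrite (inner_series1 (@Gm U) in_L2_chaos_term cvgS (L2_chaos hz) Ai).
  by rewrite (inner_chaos_term Ai hz) vi eqxx.
move=> j Aj ji; rewrite (inner_chaos_term Aj hz); case: eqP => // vj.
by move/eqP: ji; case; apply: v_inj => //; rewrite vj vi.
Qed.

Lemma inner_chaos_series0 W : L2 W ->
  (forall i, A i -> c i = 0 \/ inner (chaos (v i)) W = 0) -> inner S W = 0.
Proof.
move=> hW Wc; apply: (inner_series0 (@Gm U) in_L2_chaos_term cvgS hW) => i Ai.
rewrite innerZl//; last exact: L2_chaos (v_chain Ai).
by have [->|->] := Wc i Ai; rewrite ?mul0r ?mulr0.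
Qed.

End Limit.
End ChaosSeries.

Local Notation sig := (sigma_eta E eta).
Local Notation "'J_'" := (multint P lam E Q I e eta).

Let sigE : sig = G setT := sigma_etaE process.

Lemma XltP n (x : n.-tuple point_tm) : Xlt E n x <-> chain setT x.
Proof.
split=> [[Xx sx]|[Xx sx]]; split => //.
  by move=> y /tnthP[i ->]; split => //; exact: Xx.
by move=> i; have [] := Xx (tnth x i) (mem_tnth i x).
Qed.

Lemma prod_dR_tuple n (x : n.-tuple point_tm) w : \prod_(i < n) DR (tnth x i) w = chaos x w.
Proof. by rewrite /chaos big_tuple. Qed.

Lemma prod_kappa_tuple n (x : n.-tuple point_tm) : \prod_(i < n) kap (tnth x i).2 = kappas x.
Proof. by rewrite /kappas big_tuple. Qed.

Definition square_summable n (f : n.-tuple point_tm -> R) M :=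
  forall J : {fset n.-tuple point_tm}, \sum_(x <- J | x \in Xlt E n) f x ^+ 2 * kappas x <= M.

Lemma kernel_square_summable n (f : n.-tuple point_tm -> R) :
  kernel_L2 P lam E Q I e eta f -> exists M, square_summable f M.
Proof.
move=> [_]; set S := (\esum_(x in _) _)%E => fS.
have S0 : (0 <= S)%E.
  apply: esum_ge0 => x /XltP hx; rewrite lee_fin prod_kappa_tuple mulr_ge0 ?sqr_ge0//.
  exact/ltW/kappas_gt0/hx.
have Sfin : S \is a fin_num.
  rewrite ge0_fin_numE//; move: fS; have [->|/eqP Sy] := eqVneq S +oo%E.
    by rewrite gt0_muley// lte_fin ltr0n fact_gt0.
  by rewrite ltey => _; apply/eqP.
exists (fine S) => J; rewrite -lee_fin fineK//.
rewrite -sumEFin; apply: ereal_sup_ubound => /=.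
pose r := [seq x <- J | x \in Xlt E n].
exists [set` r].
  by split=> [|x /=]; [exact: finite_seq|rewrite mem_filter => /andP[/set_mem]].
rewrite -fsbig_seq ?filter_uniq ?fset_uniq// big_filter.
by apply: eq_bigr => x _; rewrite prod_kappa_tuple.
Qed.

Section Multint.
Variables (n : nat) (f : n.-tuple point_tm -> R) (M : R).
Hypothesis fM : square_summable f M.

Let v_inj (x y : n.-tuple point_tm) : Xlt E n x -> Xlt E n y -> tval x = tval y -> x = y.
Proof. by move=> _ _; exact: val_inj. Qed.

Let v_chain (x : n.-tuple point_tm) : Xlt E n x -> chain setT x.
Proof. by move/XltP. Qed.

Let series := L2_lim P sig summability.totally
  (partial_sum (Xlt E n) (fun x w => f x * \prod_(i < n) DR (tnth x i) w)).

Lemma multint_cvg : L2_cvg P (G setT) summability.totally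
  (partial_sum (Xlt E n) (fun x w => f x * chaos x w)) series.
Proof.
have [S cS] := chaos_series_cvg v_chain v_inj fM.
have <- : (fun (x : n.-tuple point_tm) w => f x * \prod_(i < n) DR (tnth x i) w) =
    (fun (x : n.-tuple point_tm) w => f x * chaos x w).
  by apply/funext => x; apply/funext => w; rewrite prod_dR_tuple.
rewrite /series sigE; apply: L2_limP; exists S; move: cS.
congr (L2_cvg _ _ _ (partial_sum _ _) _).
by apply/funext => x; apply/funext => w; rewrite prod_dR_tuple.
Qed.

Lemma in_L2_multint : in_L2 P (G setT) (J_ f).
Proof.
have [aS fS] := multint_cvg.1.
have S2 := in_L2_L2 (@Gm setT) multint_cvg.1.
apply: in_L2E; first exact: (adaptedZ (@sG setT)).
exact: L2Z.
Qed.

Lemma L2_multint : L2 (J_ f).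
Proof. by apply: (in_L2_L2 (@Gm setT)); exact: in_L2_multint. Qed.

Lemma inner_multint x : Xlt E n x -> inner (J_ f) (chaos x) = n`!%:R * f x * kappas x.
Proof.
move=> Xx; have S2 := in_L2_L2 (@Gm setT) multint_cvg.1.
rewrite innerZl//; last by apply: L2_chaos; exact: v_chain.
rewrite (inner_chaos_series v_chain v_inj multint_cvg (v_chain Xx) Xx erefl).
by rewrite mulrA.
Qed.

Lemma inner_multint0 W : L2 W ->
  (forall x, Xlt E n x -> f x = 0 \/ inner (chaos x) W = 0) -> inner (J_ f) W = 0.
Proof.
move=> hW Wf; have S2 := in_L2_L2 (@Gm setT) multint_cvg.1.
by rewrite innerZl// (inner_chaos_series0 v_chain multint_cvg hW Wf) mulr0.
Qed.

Lemma inner_multint_size z : chain setT z -> size z <> n -> inner (J_ f) (chaos z) = 0.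
Proof.
move=> hz zn; apply: inner_multint0; first exact: L2_chaos hz.
move=> x /XltP hx; right; rewrite (chaos_orth hx hz).
case: eqP => [xz|_]; last by rewrite mul0r.
by case: zn; rewrite -xz size_tuple.
Qed.

End Multint.

(** * Existence and uniqueness of the chaotic expansion *)

Section KernelSeries.
Variables (W : T -> R) (c : nat -> R) (g : forall n, n.-tuple point_tm -> R) (m : nat).
Hypothesis W2 : L2 W.
Hypothesis c_neq0 : forall n, (m <= n)%N -> c n != 0.
Hypothesis Wg : forall n (y : n.-tuple point_tm), (m <= n)%N -> Xlt E n y ->
  g y = 0 \/ inner W (chaos y) = c n * n`!%:R * g y * kappas y.

Lemma kernels_square_summable n : (m <= n)%N -> exists M, square_summable (@g n) M.
Proof.
(* Bessel's inequality for the coefficients [c n * n! * g y], divided by the square of the common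
   factor. *)
move=> mn; exists (sqnorm P W / (c n * n`!%:R) ^+ 2) => J.
have cn0 : 0 < (c n * n`!%:R) ^+ 2.
  by rewrite exprn_even_gt0//= mulf_neq0 ?c_neq0// pnatr_eq0 -lt0n fact_gt0.
rewrite ler_pdivlMr// mulr_suml.
have v_chain (x : n.-tuple point_tm) : Xlt E n x -> chain setT x by move/XltP.
have v_inj (x y : n.-tuple point_tm) : Xlt E n x -> Xlt E n y -> tval x = tval y -> x = y.
  by move=> _ _; exact: val_inj.
have := chaos_bessel v_chain v_inj (c := fun y => c n * n`!%:R * g y) W2.
move=> /(_ _ J); rewrite (eq_bigr (fun x => g x ^+ 2 * kappas x * (c n * n`!%:R) ^+ 2)).
  by apply => y Xy; have [->|->] := Wg mn Xy; [left; rewrite mulr0|right].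
by move=> x _; ring.
Qed.

Let J_term n : (m <= n)%N -> L2 (J_ (@g n)).
Proof. by move=> /kernels_square_summable[M gM]; exact: L2_multint gM. Qed.

Let inner_term n (y : n.-tuple point_tm) : (m <= n)%N -> Xlt E n y ->
  inner (J_ (@g n)) (chaos y) = n`!%:R * g y * kappas y.
Proof. by move=> /kernels_square_summable[M gM] Xy; exact: inner_multint gM _ Xy. Qed.

Let inner_term_size n z : (m <= n)%N -> chain setT z -> size z <> n ->
  inner (J_ (@g n)) (chaos z) = 0.
Proof. by move=> /kernels_square_summable[M gM] hz zn; exact: inner_multint_size gM _ hz zn. Qed.

Let inner_term0 n H : (m <= n)%N -> L2 H ->
  (forall x : n.-tuple point_tm, Xlt E n x -> g x = 0 \/ inner (chaos x) H = 0) ->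
  inner (J_ (@g n)) H = 0.
Proof. by move=> /kernels_square_summable[M gM]; exact: inner_multint0 gM H. Qed.

Local Notation psi := (fun n w => c n * J_ (@g n) w).

(** Common to the expansion ([W = F], [c n = 1], [m = 1]) and to the gradient ([W = F_dR],
    [c n = n.+1], [m = 0]). By hypothesis [c n * J_ g] is the projection of [W] on the chaoses [y]
    of length [n] with [g y != 0]; Bessel's inequality for [W] makes the sum over [n] converge. *)
Lemma kernel_series : exists S, [/\ L2_cvg P (G setT) \oo
    (fun N w => \sum_(m <= n < N) c n * J_ (@g n) w) S,
  (forall n (y : n.-tuple point_tm), (m <= n)%N -> Xlt E n y ->
    inner S (chaos y) = c n * n`!%:R * g y * kappas y) &
  (forall z, chain setT z -> (size z < m)%N -> inner S (chaos z) = 0)].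
Proof.
pose A := [set n | (m <= n)%N].
have psi_in n : A n -> in_L2 P (G setT) (psi n).
  move=> mn; have [M gM] := kernels_square_summable mn.
  apply: in_L2E; last by apply: L2Z; exact: J_term.
  by apply: (adaptedZ (@sG setT)); have [] := in_L2_multint gM.
have psi2 n : A n -> L2 (psi n) by move=> mn; apply: L2Z; exact: J_term.
have psi_chaos n z : A n -> chain setT z ->
    inner (psi n) (chaos z) = c n * inner (J_ (@g n)) (chaos z).
  by move=> mn hz; rewrite innerZl//; [exact: J_term|exact: L2_chaos hz].
have psi_orth n k : A n -> A k -> n != k -> inner (psi n) (psi k) = 0.
  move=> mn mk nk; rewrite innerZl; [|exact: J_term|exact: psi2].
  rewrite inner_term0 ?mulr0//; first exact: psi2.
  move=> x /XltP hx; right; rewrite innerC psi_chaos// inner_term_size ?mulr0//.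
  by rewrite size_tuple; exact/eqP.
have psi_W n : A n -> inner W (psi n) = sqnorm P (psi n).
  move=> mn; have h2 := psi2 n mn; have WB := L2B W2 h2.
  (* [W - psi n] is orthogonal to each chaos that enters [psi n] with a nonzero coefficient, hence
     to [psi n]. *)
  suff : inner (psi n) (fun w => W w - psi n w) = 0.
    by rewrite innerBr// (innerC _ _ W) => /eqP; rewrite subr_eq0 => /eqP.
  rewrite innerZl; [|exact: J_term|exact: WB].
  rewrite inner_term0 ?mulr0// => x Xx; have hx := (XltP x).1 Xx; have Lx := L2_chaos hx.
  have [->|Wx] := Wg mn Xx; [by left|right].
  by rewrite innerBr// innerC Wx innerC psi_chaos// inner_term//; ring.
have [S cS] := orthogonal_series_cvg (@Gm setT) (@sG setT) psi_in psi_orth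
  (bessel (@Gm setT) psi_in psi_orth W2 psi_W).
exists S; split.
- exact: L2_cvg_totally_seq cS.
- move=> n y mn Xy; have hy := (XltP y).1 Xy.
  rewrite (inner_series1 (@Gm setT) psi_in cS (L2_chaos hy) mn) ?psi_chaos ?inner_term//.
    by ring.
  move=> k mk kn; rewrite psi_chaos// inner_term_size ?mulr0// size_tuple.
  by apply/eqP; rewrite eq_sym.
- move=> z hz zm; apply: (inner_series0 (@Gm setT) psi_in cS (L2_chaos hz)) => n mn.
  rewrite psi_chaos// inner_term_size ?mulr0// => zn.
  by move: mn; rewrite /A /= -zn leqNgt zm.
Qed.

End KernelSeries.

Lemma inner_mean0 c z : chain setT z -> z <> [::] -> inner (fun=> c) (chaos z) = 0.
Proof.
move=> hz z0; have -> : (fun=> c) = (fun w => c * chaos [::] w) :> (T -> R).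
  by apply/funext => w; rewrite chaos_nil mulr1.
rewrite innerZl; [|exact: L2_chaos (chain_nil setT)|exact: L2_chaos hz].
rewrite (chaos_orth (chain_nil setT) hz); case: eqP => [/esym//|_].
by rewrite mul0r mulr0.
Qed.

(** The Fourier coefficient of [F] on [chaos x], divided by the factorial in front of the multiple
    integral. It is symmetric in [x], and set to 0 on tuples with a repeated time, where kernels do
    not matter. *)
Definition chaos_kernel (F : T -> R) n (x : n.-tuple point_tm) : R :=
  if uniq [seq p.1 | p <- x] then inner F (chaos x) / (n`!%:R * kappas x) else 0.

Lemma chaos_kernelE F n (x : n.-tuple point_tm) : Xlt E n x ->
  inner F (chaos x) = n`!%:R * chaos_kernel F x * kappas x.
Proof.
move=> /XltP hx; have := kappas_gt0 hx; rewrite /chaos_kernel.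
have -> : uniq [seq p.1 | p <- x] by case: hx => _; rewrite ltn_sorted_uniq_leq => /andP[].
have : n`!%:R != 0 :> R by rewrite pnatr_eq0 -lt0n fact_gt0.
by move=> n0 k0; field; rewrite n0 gt_eqF.
Qed.

Lemma square_summable_kernel_L2 n (f : n.-tuple point_tm -> R) M :
  (forall (s : 'S_n) x, Xn E n x -> f [tuple tnth x (s i) | i < n] = f x) ->
  square_summable f M -> kernel_L2 P lam E Q I e eta f.
Proof.
move=> fsym fM; split=> //.
apply: (@le_lt_trans _ _ (n`!%:R%:E * M%:E)%E); last by rewrite -EFinM ltry.
apply: lee_wpmul2l; first by rewrite lee_fin ler0n.
apply: ge_ereal_sup => _ [A [fA AX] <-].
rewrite fsbig_finite//= sumEFin lee_fin; apply: le_trans (fM (fset_set A)).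
rewrite big_seq [leRHS]big_mkcond big_seq; apply: ler_sum => x; rewrite in_fset_set// inE => Ax.
by rewrite mem_set ?prod_kappa_tuple//; exact: AX.
Qed.

(** Existence of the expansion, without which [gradient] could be its default value. The sum of the
    series and [F - E[F]] have the same inner product with every chaos, so totality identifies
    them. *)
Lemma is_chaos_kernel F : in_L2 P (G setT) F ->
  is_chaos P lam E Q I e eta F (fun n => @chaos_kernel F n).
Proof.
move=> inF; have F2 := in_L2_L2 (@Gm setT) inF.
have one0 n : (1 <= n)%N -> (fun=> 1 : R) n != 0 by move=> _; exact: oner_neq0.
have Wg n (y : n.-tuple point_tm) : (1 <= n)%N -> Xlt E n y ->
    chaos_kernel F y = 0 \/ inner F (chaos y) = 1 * n`!%:R * chaos_kernel F y * kappas y.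
  by move=> _ Xy; right; rewrite mul1r chaos_kernelE.
split=> [n n0|].
  have [M fM] := kernels_square_summable F2 one0 Wg n0.
  apply: square_summable_kernel_L2 fM => s x _.
  have px : perm_eq [tuple tnth x (s i) | i < n] x by apply/tuple_permP; exists s.
  by rewrite /chaos_kernel (perm_uniq (perm_map fst px)) (chaos_perm px) (kappas_perm px).
have [S [cS Sy S0]] := kernel_series F2 one0 Wg.
rewrite sigE; apply: L2_cvg_shift => //.
have inFc : in_L2 P (G setT) (fun w => F w - mean P F).
  apply: in_L2E; last by apply: L2B => //; exact: L2_cst.
  by apply: (adaptedB (@sG setT)) => //; [case: inF|exact: (adapted_cst (@sG setT))].
have Jn n : (1 <= n)%N -> L2 (J_ (@chaos_kernel F n)).
  by move=> n0; have [M fM] := kernels_square_summable F2 one0 Wg n0; exact: L2_multint fM.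
have cS' : L2_cvg P (G setT) \oo (fun N w => \sum_(1 <= n < N) J_ (@chaos_kernel F n) w) S.
  move: cS; congr (L2_cvg _ _ _ _ _); apply/funext => N; apply/funext => w.
  by apply: eq_bigr => n _; rewrite mul1r.
have S2 := in_L2_L2 (@Gm setT) cS.1; have Fc2 := in_L2_L2 (@Gm setT) inFc.
apply: (L2_cvg_ae (@Gm setT) _ inFc _ cS') => [N|].
  under eq_fun do rewrite big_nat.
  by apply: L2_sum => n /andP[n0 _]; exact: Jn.
apply: (@orth_adapted_sqnorm0 setT); last 2 first.
- exact: L2B.
- move=> z hz; have Lz := L2_chaos hz; rewrite innerBl// innerBl//; last exact: L2_cst.
  have [z0|/eqP z0] := eqVneq z [::].
    rewrite z0 S0// chaos_nil !inner_cst1 mean_cst; ring.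
  rewrite inner_mean0//.
  have sz : (1 <= size z)%N by rewrite lt0n size_eq0; exact/eqP.
  have Xz : Xlt E (size z) (in_tuple z) by exact/XltP.
  rewrite (Sy _ (in_tuple z) sz Xz) (chaos_kernelE F Xz); ring.
apply: (adaptedB (@sG setT)); [by case: cS => -[]|by case: inFc].
Qed.

(** Only the term of order [n] meets [chaos x], so the inner products of the partial sums are
    eventually constant. The kernels of any expansion are thereby determined by [F], whichever one
    [gradient] selects. *)
Lemma is_chaosE F f n (x : n.-tuple point_tm) : is_chaos P lam E Q I e eta F f ->
  (0 < n)%N -> Xlt E n x -> inner F (chaos x) = n`!%:R * f n x * kappas x.
Proof.
move=> [fk]; rewrite sigE => cF n0 Xx; have hx := (XltP x).1 Xx; have Lx := L2_chaos hx.
have Jk k : (0 < k)%N -> L2 (J_ (f k)).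
  by move=> /fk/kernel_square_summable[M fM]; exact: L2_multint fM.
have LS N : L2 (fun w => \sum_(1 <= k < N) J_ (f k) w).
  apply: (eq_L2 (X := fun w => \sum_(1 <= k < N | (1 <= k < N)%N) J_ (f k) w)).
    by move=> w; rewrite -big_nat.
  by apply: L2_sum => k /andP[k0 _]; exact: Jk.
have Ln N : L2 (fun w => mean P F + \sum_(1 <= k < N) J_ (f k) w).
  by apply: L2D => //; exact: L2_cst.
have /cvg_unique : inner (fun w => mean P F + \sum_(1 <= k < N) J_ (f k) w) (chaos x) @[N --> \oo]
    --> inner F (chaos x) by exact: (L2_cvg_inner (@Gm setT) Ln Lx cF).
apply => //.
apply: cvg_near_cst; exists n.+1 => // N /= nN.
rewrite innerDl//; last exact: L2_cst.
rewrite inner_mean0 ?add0r//; last first.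
  by move=> x0; move: n0; rewrite -(size_tuple x) x0.
have -> : (fun w => \sum_(1 <= k < N) J_ (f k) w) =
    (fun w => \sum_(1 <= k < N | (1 <= k < N)%N) J_ (f k) w).
  by apply/funext => w; rewrite -big_nat.
rewrite inner_suml//; last by move=> k /andP[k0 _]; exact: Jk.
rewrite -big_nat (bigD1_seq n) ?iota_uniq ?mem_index_iota ?n0//=.
have [M fM] := kernel_square_summable (fk n n0).
rewrite (inner_multint fM Xx) big_seq_cond big1 ?addr0// => k /andP[].
rewrite mem_index_iota => /andP[k0 _] kn; have [M' fM'] := kernel_square_summable (fk k k0).
by apply: (inner_multint_size fM' hx); rewrite size_tuple; apply/eqP; rewrite eq_sym.
Qed.

(** Extends the formula by symmetry to unsorted tuples. A slice evaluates the kernel at [rcons y x],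
    where [x] need not be the latest point. *)
Lemma is_chaosE_uniq F f n (x : n.-tuple point_tm) : is_chaos P lam E Q I e eta F f ->
  (0 < n)%N -> points_in setT x -> uniq [seq p.1 | p <- x] ->
  inner F (chaos x) = n`!%:R * f n x * kappas x.
Proof.
move=> hf n0 Xx ux; have px := perm_sort_time x.
have /tuple_permP[s sE] := px.
have xn : Xn E n x by move=> i; have [] := Xx _ (mem_tnth i x).
have <- := (hf.1 n n0).1 s x xn.
have hs := chain_sort_time Xx ux.
rewrite -(chaos_perm px) -(kappas_perm px) sE; apply: is_chaosE => //.
by apply/XltP; rewrite -sE.
Qed.

Local Notation DF := (gradient P lam E Q I e eta).

(** * The gradient and its conditional expectation *)

Section Gradient.
Variables (F : T -> R) (x : point_tm).
Hypothesis inF : in_L2 P (G setT) F.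
Hypothesis Xx : XX x.

Let F2 : L2 F := in_L2_L2 (@Gm setT) inF.

Definition F_dR w : R := (kap x.2)^-1 * (F w * DR x w).

Lemma L2_F_dR : L2 F_dR.
Proof. by apply: L2Z; exact: L2_mul_dR. Qed.

Lemma inner_F_dR X : L2 X ->
  inner F_dR X = (kap x.2)^-1 * inner F (fun w => X w * DR x w).
Proof.
move=> hX; rewrite innerZl//; last exact: L2_mul_dR.
by congr (_ * _); congr mean; apply/funext => w; ring.
Qed.

Lemma inner_F_dR_chaos z : chain setT z ->
  inner F_dR (chaos z) = (kap x.2)^-1 * inner F (chaos (rcons z x)).
Proof.
move=> hz; rewrite inner_F_dR; last exact: L2_chaos hz.
by congr (_ * _); congr inner; apply/funext => w; rewrite chaos_rcons.
Qed.

(** The factorial $(n+1)!$ of the expansion splits into the factor [n.+1] of the gradient and the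
    $n!$ of the multiple integral; the [kap x.2] coming from the added point cancels the one in
    [F_dR]. *)
Lemma slice_F_dR f n (y : n.-tuple point_tm) : is_chaos P lam E Q I e eta F f ->
  Xlt E n y -> x.1 \notin [seq p.1 | p <- y] ->
  inner F_dR (chaos y) = n.+1%:R * n`!%:R * slice (f n.+1) x y * kappas y.
Proof.
move=> hf Xy xy; have hy := (XltP y).1 Xy; rewrite inner_F_dR_chaos//.
have uy : uniq [seq p.1 | p <- rcons y x].
  rewrite map_rcons rcons_uniq xy.
  by case: hy => _; rewrite ltn_sorted_uniq_leq => /andP[].
have py : points_in setT (rcons y x).
  by move=> u; rewrite mem_rcons inE => /predU1P[->//|/hy.1].
have := is_chaosE_uniq (x := [tuple of rcons y x]) hf isT py uy.
rewrite [tval [tuple of rcons y x]]/= => ->.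
have -> : slice (f n.+1) x y = f n.+1 [tuple of rcons y x].
  rewrite /slice (_ : all _ _ = true) ?mulr1//.
  apply/allP => p py'; apply: contraNneq xy => <-; exact: map_f.
rewrite kappas_rcons factS natrM; have := kappa_gt0 Xx.2 => k0.
by field; rewrite gt_eqF.
Qed.

Lemma slice_eq0 (f : forall n, n.-tuple point_tm -> R) n (y : n.-tuple point_tm) :
  x.1 \in [seq p.1 | p <- y] -> slice (f n.+1) x y = 0.
Proof.
move=> /mapP[p py xp]; rewrite /slice (_ : all _ _ = false) ?mulr0//.
by apply/negbTE/allPn; exists p => //; rewrite xp negbK.
Qed.

Let Wg f : is_chaos P lam E Q I e eta F f ->
  forall n (y : n.-tuple point_tm), (0 <= n)%N -> Xlt E n y ->
  slice (f n.+1) x y = 0 \/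
  inner F_dR (chaos y) = n.+1%:R * n`!%:R * slice (f n.+1) x y * kappas y.
Proof.
move=> hf n y _ Xy; have [xy|xy] := boolP (x.1 \in [seq p.1 | p <- y]).
  by left; exact: slice_eq0.
by right; exact: slice_F_dR.
Qed.

(** [kernel_series] for [F_dR] shows that the gradient series converges, so that the selection in
    [gradient] is not the default. The comparison is limited to chains before [x] because the
    conditional expectation sees no others. *)
Lemma gradientP : in_L2 P (G setT) (DF F x) /\
  forall y, chain (before x.1) y -> inner (DF F x) (chaos y) = inner F_dR (chaos y).
Proof.
have c0 n : (0 <= n)%N -> (n.+1%:R : R) != 0 by rewrite pnatr_eq0.
set D := [set Y | exists2 f, is_chaos P lam E Q I e eta F f & L2_cvg P sig \oo
  (fun N w => \sum_(0 <= n < N) n.+1%:R * J_ (slice (f n.+1) x) w) Y].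
have [f hf cY] : D (DF F x).
  apply: xgetPex; have hf := is_chaos_kernel inF.
  have [S [cS _ _]] := kernel_series L2_F_dR c0 (Wg hf).
  by exists S; exists (fun n => @chaos_kernel F n); rewrite ?sigE.
rewrite sigE in cY; split; first by case: cY.
(* The selected [f] need not be [chaos_kernel F]: the series is formed again with this [f], and its
   sum [S] agrees with the gradient up to a null set. *)
have [S [cS Sy _]] := kernel_series L2_F_dR c0 (Wg hf).
move=> y hy; have hyT : chain setT y by exact: chain_sub hy.
have JN N : L2 (fun w => \sum_(0 <= n < N) n.+1%:R * J_ (slice (f n.+1) x) w).
  apply: L2_sum => n _; apply: L2Z.
  by have [M fM] := kernels_square_summable L2_F_dR c0 (Wg hf) (leq0n n); exact: L2_multint fM.
have S2 := in_L2_L2 (@Gm setT) cS.1; have Y2 := in_L2_L2 (@Gm setT) cY.1.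
have Ly := L2_chaos hyT.
have : inner (fun w => DF F x w - S w) (chaos y) = 0.
  apply: inner_sqnorm0 => //; first exact: L2B.
  exact: (L2_cvg_unique (@Gm setT) JN cY cS).
rewrite innerBl// => /eqP; rewrite subr_eq0 => /eqP ->.
have Xy : Xlt E (size y) (in_tuple y) by exact/XltP.
rewrite (Sy _ (in_tuple y) isT Xy) -slice_F_dR//.
apply/mapP => -[p py xp]; have [_] := hy.1 p py.
by rewrite -xp /= ltnn.
Qed.

(** [S] is the projection of [F_dR] on the past, built as a series of chaoses, and satisfies the
    definition of the conditional expectation. The version selected by [condexp] differs from it on
    a null set only, and thus lies in $L^2$ as well. *)
Lemma condexp_gradient : exists S,
  [/\ in_L2 P (G (before x.1)) (condexp P (G (before x.1)) (DF F x)),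
      L2_cvg P (G (before x.1)) summability.totally (partial_sum [set z | chain (before x.1) z]
        (fun z w => inner F_dR (chaos z) / kappas z * chaos z w)) S,
      forall y, chain (before x.1) y -> inner S (chaos y) = inner F_dR (chaos y) &
      sqnorm P (fun w => condexp P (G (before x.1)) (DF F x) w - S w) = 0].
Proof.
set U := before x.1; set A := [set z | chain U z].
have v_chain z : A z -> chain U z by [].
have v_inj z z' : A z -> A z' -> id z = id z' -> z = z' by [].
have Wc z : A z -> inner F_dR (chaos z) / kappas z = 0 \/
    inner F_dR (chaos z) = inner F_dR (chaos z) / kappas z * kappas z.
  by move=> Az; right; rewrite divfK// gt_eqF// (kappas_gt0 Az).
have [S cS] := chaos_series_cvg v_chain v_inj (chaos_bessel v_chain v_inj L2_F_dR Wc).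
have Sy y : chain U y -> inner S (chaos y) = inner F_dR (chaos y).
  move=> hy; rewrite (inner_chaos_series v_chain v_inj cS hy hy erefl).
  by rewrite divfK// gt_eqF// (kappas_gt0 hy).
have S2 := in_L2_L2 (@Gm U) cS.1; have Y2 := in_L2_L2 (@Gm setT) gradientP.1.
have int X B : L2 X -> measurable B -> P.-integrable B (EFin \o X).
  move=> hX mB; apply: integrableS (measurableT) mB _ _ => //.
  by apply/Lfun1_integrable; exact: L2_Lfun1.
(* [S - DF F x] is orthogonal to the chaoses of the past, hence to the indicators of past events,
   though the gradient need not be adapted to the past. *)
have SE B : G U B -> (\int[P]_(w in B) (S w)%:E = \int[P]_(w in B) (DF F x w)%:E)%E.
  move=> GB; have mB := @Gm U _ GB.
  have LB := L2B S2 Y2.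
  have : inner (fun w => S w - DF F x w) (\1_B) = 0.
    apply: (orth_hit_sigma LB _ GB) => z hz; have Lz := L2_chaos hz.
    by rewrite innerBl// Sy// gradientP.2// subrr.
  rewrite innerBl//; last exact: L2_indic.
  rewrite /inner !mean_integral// => /eqP; rewrite subr_eq0 => /eqP h.
  by rewrite -[LHS]fineK ?h ?fineK//; apply: integrable_fin_num => //; exact: int.
have exS : is_condexp P (G U) (DF F x) S.
  split => //; first by case: cS => -[].
  exact: int.
have [aC iC CE] := xgetPex (cst 0)
  (ex_intro _ S exS : exists Y, [set Y | is_condexp P (G U) (DF F x) Y] Y).
rewrite -/(condexp P (G U) (DF F x)) in aC iC CE.
set C := condexp P (G U) (DF F x) in aC iC CE *.
have aS : adapted (G U) S by case: cS => -[].
have aCS : adapted (G U) (fun w => C w - S w) by exact: (adaptedB (@sG U)).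
have C1 : C \in Lfun P 1 by exact/Lfun1_integrable.
have CS0 : ae_eq P setT (fun w => C w - S w) (cst 0).
  apply: (adapted_ae0 (@Gm U) (@sG U) aCS).
    by apply: rpredB => //; exact: L2_Lfun1.
  move=> B GB; have mB := @Gm U _ GB.
  rewrite mean_integral//.
  have iCB : P.-integrable B (EFin \o C) by apply: integrableS iC.
  have -> : (\int[P]_(w in B) (C w - S w)%:E =
      \int[P]_(w in B) (C w)%:E - \int[P]_(w in B) (S w)%:E)%E.
    by rewrite -integralB_EFin//; exact: int.
  by rewrite CE// SE// subee// integrable_fin_num//; exact: int.
have [CS2 CSn] := ae0_L2 (adapted_measurable (@Gm U) aCS) CS0.
exists S; split => //.
apply: in_L2E => //; apply: eq_L2 (L2D CS2 S2) => w; by rewrite subrK.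
Qed.

End Gradient.

(** * The terms of the Clark formula and their sum *)

Section ClarkFormula.
Variable F : T -> R.
Hypothesis inF : in_L2 P (G setT) F.

Let F2 : L2 F := in_L2_L2 (@Gm setT) inF.

Let C x : T -> R := condexp P (G (before x.1)) (DF F x).

Let inC x : XX x -> in_L2 P (G (before x.1)) (C x).
Proof. by move=> Xx; have [S []] := condexp_gradient inF Xx. Qed.

Let C2 x : XX x -> L2 (C x).
Proof. by move=> Xx; apply: (in_L2_L2 (@Gm (before x.1))); exact: inC. Qed.

Let inner_C_chaos x y : XX x -> chain (before x.1) y ->
  inner (C x) (chaos y) = (kap x.2)^-1 * inner F (chaos (rcons y x)).
Proof.
move=> Xx hy; have [S [_ cS Sy CS]] := condexp_gradient inF Xx.
have hyT : chain setT y by exact: chain_sub hy.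
have S2 := in_L2_L2 (@Gm (before x.1)) cS.1; have Ly := L2_chaos hy.
rewrite -inner_F_dR_chaos// -Sy//; apply/eqP; rewrite -subr_eq0 -innerBl//; last exact: C2.
by apply/eqP; apply: inner_sqnorm0 => //; apply: L2B => //; exact: C2.
Qed.

(* [C x] lies in the closed span of the chaoses of the chains before [x]. *)
Let inner_C0 x W : XX x -> L2 W ->
  (forall y, chain (before x.1) y -> inner (chaos y) W = 0) -> inner (C x) W = 0.
Proof.
move=> Xx hW W0; have [S [_ cS Sy CS]] := condexp_gradient inF Xx.
have S2 := in_L2_L2 (@Gm (before x.1)) cS.1.
have <- : inner S W = 0.
  apply: (inner_chaos_series0 _ cS hW) => [z //|z hz]; right; exact: W0.
apply/eqP; rewrite -subr_eq0 -innerBl//; last exact: C2.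
by apply/eqP; apply: inner_sqnorm0 => //; apply: L2B => //; exact: C2.
Qed.

Local Notation psi := (fun x w => C x w * DR x w).

Let chain_last x y : XX x -> chain (before x.1) y -> chain setT (rcons y x).
Proof.
move=> Xx hy; apply/chain_rcons; split => //.
by apply: chain_sub hy => s /=.
Qed.

Let psi_in x : XX x -> in_L2 P (G setT) (psi x).
Proof.
move=> Xx; apply: in_L2E; last by apply: L2_mul_dR => //; exact: C2.
apply: (adaptedM (@sG setT)); last by apply: (simple_adapted (@sG setT)); exact: simple_dR.
by move=> B mB; apply: hit_sigma_sub ((inC Xx).1 B mB).
Qed.

Let psi2 x : XX x -> L2 (psi x).
Proof. by move=> Xx; apply: L2_mul_dR => //; exact: C2. Qed.

Let inner_psi x W : inner (psi x) W = inner (C x) (fun w => W w * DR x w).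
Proof. by congr mean; apply/funext => w; ring. Qed.

Let inner_chaos_dR y x W : inner (chaos y) (fun w => W w * DR x w) = inner (chaos (rcons y x)) W.
Proof. by congr mean; apply/funext => w; rewrite chaos_rcons; ring. Qed.

(** [psi x] lies in the closed span of the chaoses whose last point is [x]; these spans are
    orthogonal for different [x]. *)
Let inner_psi0 x W : XX x -> L2 W ->
  (forall y, chain (before x.1) y -> inner (chaos (rcons y x)) W = 0) -> inner (psi x) W = 0.
Proof.
move=> Xx hW W0; rewrite inner_psi; apply: inner_C0 => //; first exact: L2_mul_dR.
by move=> y hy; rewrite inner_chaos_dR W0.
Qed.

Let inner_psi_chaos0 x z : XX x -> chain setT z ->
  (forall y, chain (before x.1) y -> rcons y x <> z) -> inner (psi x) (chaos z) = 0.
Proof.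
move=> Xx hz nz; apply: inner_psi0 => //; first exact: L2_chaos hz.
move=> y hy; rewrite (chaos_orth (chain_last Xx hy) hz).
by case: eqP => [/(nz y hy)//|_]; rewrite mul0r.
Qed.

Let psi_orth x x' : XX x -> XX x' -> x != x' -> inner (psi x) (psi x') = 0.
Proof.
move=> Xx Xx' xx'; apply: inner_psi0 => //; first exact: psi2.
move=> y hy; rewrite innerC; apply: inner_psi_chaos0 => //; first exact: chain_last.
by move=> y' _ /eqP; rewrite eqseq_rcons => /andP[_ /eqP xE]; move: xx'; rewrite xE eqxx.
Qed.

(* Conditionally on the past, [DR x ^+ 2] has mean [kap x.2]. *)
Let inner_psi_dR x W : XX x -> L2 W ->
  (forall y, chain (before x.1) y ->
    inner (chaos y) (fun w => W w * (DR x w ^+ 2 - kap x.2)) = 0) ->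
  inner (psi x) (fun w => W w * DR x w) = kap x.2 * inner (C x) W.
Proof.
move=> Xx hW W0; have LW : L2 (fun w => W w * (DR x w ^+ 2 - kap x.2)).
  have := L2B (L2_mul_dR (L2_mul_dR hW Xx) Xx) (L2Z (kap x.2) hW).
  by apply: eq_L2 => w; ring.
have := inner_C0 Xx LW W0.
have -> : inner (C x) (fun w => W w * (DR x w ^+ 2 - kap x.2)) =
    inner (C x) (fun w => W w * DR x w * DR x w - kap x.2 * W w).
  by congr inner; apply/funext => w; ring.
rewrite innerBr; [|exact: L2_mul_dR (L2_mul_dR hW Xx) Xx|exact: L2Z|exact: C2].
rewrite innerZr//; last exact: C2.
by rewrite -inner_psi => /eqP; rewrite subr_eq0 => /eqP.
Qed.

(** By [chaos_orth] both parts of the difference equal [kap x.2 * kappas y] if [y = y'] and 0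
    otherwise. *)
Let chaos_dR2 x y y' : XX x -> chain (before x.1) y -> chain (before x.1) y' ->
  inner (chaos y) (fun w => chaos y' w * (DR x w ^+ 2 - kap x.2)) = 0.
Proof.
move=> Xx hy hy'; have Ly := L2_chaos hy; have Ly' := L2_chaos hy'.
have -> : inner (chaos y) (fun w => chaos y' w * (DR x w ^+ 2 - kap x.2)) =
    inner (chaos y) (fun w => chaos (rcons y' x) w * DR x w - kap x.2 * chaos y' w).
  by congr inner; apply/funext => w; rewrite chaos_rcons; ring.
have Lr := L2_chaos (chain_last Xx hy').
rewrite innerBr//; [|exact: L2_mul_dR|exact: L2Z].
rewrite inner_chaos_dR innerZr// (chaos_orth (chain_last Xx hy) (chain_last Xx hy')).
by rewrite (chaos_orth hy hy') eqseq_rcons eqxx andbT kappas_rcons; ring.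
Qed.

Let inner_psi_chaos x y : XX x -> chain (before x.1) y ->
  inner (psi x) (chaos (rcons y x)) = inner F (chaos (rcons y x)).
Proof.
move=> Xx hy; have Ly := L2_chaos hy.
have -> : chaos (rcons y x) = (fun w => chaos y w * DR x w).
  by apply/funext => w; rewrite chaos_rcons.
rewrite inner_psi_dR//; last by move=> y' hy'; exact: chaos_dR2.
rewrite inner_C_chaos// mulrA divff ?mul1r; last by rewrite gt_eqF// (kappa_gt0 Xx.2).
by congr inner; apply/funext => w; rewrite chaos_rcons.
Qed.

(** The left side is [inner (C x) (F * DR x)] and the right side [kap x.2 * inner (C x) (C x)]. The
    difference [F * DR x - kap x.2 * C x] is orthogonal to the chaoses before [x], hence to [C x],
    which is in their closed span. *)
Let inner_F_psi x : XX x -> inner F (psi x) = sqnorm P (psi x).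
Proof.
move=> Xx; have LC := C2 Xx.
have LFd := L2_mul_dR F2 Xx.
rewrite /sqnorm inner_psi_dR//; last first.
  (* Here [inner_psi_dR] is applied to [W = C x], itself only a limit: its hypothesis follows from
     [chaos_dR2] by another use of [inner_C0]. *)
  move=> y hy; rewrite innerC.
  have -> : inner (fun w => C x w * (DR x w ^+ 2 - kap x.2)) (chaos y) =
      inner (C x) (fun w => chaos y w * (DR x w ^+ 2 - kap x.2)).
    by congr mean; apply/funext => w; ring.
  apply: inner_C0 => //; last by move=> y' hy'; exact: chaos_dR2.
  have Ly := L2_chaos hy.
  have := L2B (L2_mul_dR (L2_mul_dR Ly Xx) Xx) (L2Z (kap x.2) Ly).
  by apply: eq_L2 => w; ring.
suff : inner (C x) (fun w => F w * DR x w - kap x.2 * C x w) = 0.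
  rewrite innerBr//; last exact: L2Z.
  by rewrite innerZr// -inner_psi innerC => /eqP; rewrite subr_eq0 => /eqP.
apply: inner_C0 => //; first by apply: L2B => //; exact: L2Z.
move=> y hy; have Ly := L2_chaos hy.
rewrite innerBr//; last exact: L2Z.
rewrite inner_chaos_dR innerZr// (innerC _ _ (C x)) inner_C_chaos// innerC.
rewrite mulrA divff ?mul1r ?subrr//.
by rewrite gt_eqF// (kappa_gt0 Xx.2).
Qed.

(** A nonempty chain [rcons y x] meets only the term of its latest point [x], and there with the
    inner product of [F]; the empty chain is settled by the subtraction of the mean. *)
Lemma clark_formula : L2_cvg P (G setT) summability.totally
  (fun J w => mean P F + partial_sum XX psi J w) F.
Proof.
have [S cS] := orthogonal_series_cvg (@Gm setT) (@sG setT) psi_in psi_orth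
  (bessel (@Gm setT) psi_in psi_orth F2 inner_F_psi).
apply: L2_cvg_shift => //.
have S2 := in_L2_L2 (@Gm setT) cS.1.
have inFc : in_L2 P (G setT) (fun w => F w - mean P F).
  apply: in_L2E; last by apply: L2B => //; exact: L2_cst.
  by apply: (adaptedB (@sG setT)); [case: inF|exact: (adapted_cst (@sG setT))].
have Fc2 := in_L2_L2 (@Gm setT) inFc.
apply: (L2_cvg_ae (@Gm setT) _ inFc _ cS) => [J|].
  exact: (L2_partial_sum (@Gm setT) psi_in).
apply: (@orth_adapted_sqnorm0 setT).
- by apply: (adaptedB (@sG setT)); [case: cS => -[]|case: inFc].
- exact: L2B.
move=> z hz; have Lz := L2_chaos hz; rewrite innerBl// innerBl//; last exact: L2_cst.
case/lastP: z hz Lz => [|y x] hz Lz.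
  rewrite (inner_series0 (@Gm setT) psi_in cS Lz) ?chaos_nil ?inner_cst1 ?mean_cst ?subrr//.
  move=> x Xx; rewrite -chaos_nil; apply: inner_psi_chaos0 => // y _; by case: y.
have /chain_rcons[hy' Xx _] := hz.
have hy : chain (before x.1) y by apply: chain_sub hy' => s [].
rewrite inner_mean0 ?subr0//; last by case: (y).
rewrite (inner_series1 (@Gm setT) psi_in cS Lz Xx) ?inner_psi_chaos ?subrr//.
move=> x' Xx' xx'; apply: inner_psi_chaos0 => // y' _ /eqP.
by rewrite eqseq_rcons => /andP[_ /eqP xE]; move: xx'; rewrite xE eqxx.
Qed.

End ClarkFormula.
End ChaosOrthogonality.

Theorem proposition4p4 (d : measure_display) (T : measurableType d)
  (R : realType) (P : probability T R)
  (lam : R) (E : set int) (Q : probability int R)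
  (I : set nat) (e : nat -> int)
  (xi : nat -> {RV P >-> nat}) (V : nat -> {RV P >-> int})
  (lam01 : 0 < lam < 1)
  (Q_on_E : Q E = 1%E)
  (Q_gt0 : forall k, E k -> (0 < Q [set k])%E)
  (E_enum : enumeration I E e)
  (process : is_marked_binomial xi V lam E Q)
  (F : T -> R)
  (F_L2 : in_L2 P (sigma_eta E (marked_process xi V)) F) :
  let eta := marked_process xi V in
  let D := gradient P lam E Q I e eta in
  let DR := dR P lam Q I e eta in
  L2_cvg P (sigma_eta E eta) summability.totally
    (fun J w => mean P F +
       partial_sum (XX E)
         (fun x v => condexp P (filtration E eta x.1.-1) (D F x) v * DR x v)
         J w)
    F.
Proof.
move=> eta D DR; rewrite (sigma_etaE process) in F_L2 *.
have := clark_formula lam01 Q_gt0 E_enum process F_L2.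
congr (L2_cvg _ _ _ _ _); apply/funext => J; apply/funext => w; congr (_ + _).
apply: eq_bigr => x /set_mem [x0 _].
(* The points of [XX] have positive times, so [s <= x.1.-1] and [s < x.1] are equivalent. *)
rewrite (filtrationE process) (_ : [set s | (s <= x.1.-1)%N] = [set s | (s < x.1)%N])//.
by apply/seteqP; split => s /=; lia.
Qed.
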